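(* Let $x,y,z_1,z_2,z_3,z_4$ be indeterminates. For every integer $n\ge 3$ (and also for $n=2$, if $Z_0(x,y)$ is taken to be $1$), the quadruply-refined ASM generating function satisfies $$\begin{aligned} &y(z_4-z_2)(z_1-z_3)\,Z^{\mathrm{quad}}_n(x,y;z_1,z_2,z_3,z_4)\,Z_{n-2}(x,y)=\\ &\bigl((z_1-1)(z_2-1)-yz_1z_2\bigr)\bigl((z_3-1)(z_4-1)-yz_3z_4\bigr)\,Z^{\mathrm{adj}}_{n-1}(x,y;z_4,z_1)\,Z^{\mathrm{adj}}_{n-1}(x,y;z_2,z_3)\\ &-\bigl(x(z_4-1)(z_1-1)-y\bigr)\bigl(x(z_2-1)(z_3-1)-y\bigr)\,z_1z_2z_3z_4\,\widetilde{Z}^{\mathrm{adj}}_{n-1}(x,y;z_1,z_2)\,\widetilde{Z}^{\mathrm{adj}}_{n-1}(x,y;z_3,z_4)\\ &-(z_2-1)(z_3-1)\bigl((z_4-1)(z_1-1)-yz_4z_1\bigr)\,Z^{\mathrm{adj}}_{n-1}(x,y;z_4,z_1)\,Z_{n-2}(x,y)\\ &+(z_3-1)(z_4-1)\bigl(x(z_1-1)(z_2-1)-y\bigr)\,z_1z_2\,(xz_3z_4)^{n-1}\,\widetilde{Z}^{\mathrm{adj}}_{n-1}(x,y;z_1,z_2)\,Z_{n-2}(x,y)\\ &-(z_4-1)(z_1-1)\bigl((z_2-1)(z_3-1)-yz_2z_3\bigr)\,Z^{\mathrm{adj}}_{n-1}(x,y;z_2,z_3)\,Z_{n-2}(x,y)\\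 &+(z_1-1)(z_2-1)\bigl(x(z_3-1)(z_4-1)-y\bigr)\,z_3z_4\,(xz_1z_2)^{n-1}\,\widetilde{Z}^{\mathrm{adj}}_{n-1}(x,y;z_3,z_4)\,Z_{n-2}(x,y)\\ &+(z_1-1)(z_2-1)(z_3-1)(z_4-1)\bigl(1-(x^2z_1z_2z_3z_4)^{n-1}\bigr)\,Z_{n-2}(x,y)^2. \end{aligned}$$
   Context: An alternating sign matrix (ASM) is a square matrix with entries in $\{0,1,-1\}$ such that along each row and each column the nonzero entries alternate in sign and sum to $1$. $\mathrm{ASM}(n)$ is the set of $n\times n$ ASMs. The first and last rows and columns of an ASM each contain exactly one $1$, all other entries there being $0$. For $A\in\mathrm{ASM}(n)$ define: $\nu(A)=\sum_{1\le i<i'\le n,\;1\le j'\le j\le n}A_{ij}A_{i'j'}$ (a nonnegative integer); $\mu(A)=$ number of $-1$'s in $A$; $\rho_{\mathrm T}(A)=$ number of $0$'s to the left of the $1$ in the top row; $\rho_{\mathrm R}(A)=$ number of $0$'s below the $1$ in the right-most column; $\rho_{\mathrm B}(A)=$ number of $0$'s to the right of the $1$ in the bottom row; $\rho_{\mathrm L}(A)=$ number of $0$'s above the $1$ in the left-most column. Generating functions (for $n\ge1$): $Z^{\mathrm{quad}}_n(x,y;z_1,z_2,z_3,z_4)=\sum_{A\in\mathrm{ASM}(n)}x^{\nu(A)}y^{\mu(A)}z_1^{\rho_{\mathrm T}(A)}z_2^{\rho_{\mathrm R}(A)}z_3^{\rho_{\mathrm B}(A)}z_4^{\rho_{\mathrm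 L}(A)}$; $Z^{\mathrm{adj}}_n(x,y;z_1,z_2)=Z^{\mathrm{quad}}_n(x,y;z_1,1,1,z_2)$; $\widetilde{Z}^{\mathrm{adj}}_n(x,y;z_1,z_2)=Z^{\mathrm{quad}}_n(x,y;z_1,z_2,1,1)$; $Z_n(x,y)=Z^{\mathrm{quad}}_n(x,y;1,1,1,1)$. *)

(* Defs.v *)
From HB Require Import structures.
From mathcomp Require Import all_boot all_order all_algebra.

Set Implicit Arguments.
Unset Strict Implicit.
Unset Printing Implicit Defensive.

Import Order.TTheory GRing.Theory Num.Theory.
Local Open Scope ring_scope.

Definition asm_entries : seq int := [:: 0; 1; -1].

Definition alternating_line (s : seq int) : bool :=
  sorted (fun a b => a * b < 0) [seq a <- s | a != 0] && (\sum_(a <- s) a == 1).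

(* The unique 0 x 0 matrix satisfies this vacuously. *)
Definition is_asm n (A : 'M[int]_n) : bool :=
  [&& [forall i, forall j, A i j \in asm_entries],
      [forall i, alternating_line [seq A i j | j : 'I_n]]
    & [forall j, alternating_line [seq A i j | i : 'I_n]]].

Record asm (n : nat) := ASM { asm_mx :> 'M[int]_n; asm_mxP : is_asm asm_mx }.

HB.instance Definition _ n := [isSub for @asm_mx n].
HB.instance Definition _ n := [Countable of asm n by <:].

(* 'M[int]_n is not finite, so finiteness of asm n is obtained by encoding
   the entries in a three-element type. *)
Section AsmFinite.
Variable n : nat.

Definition asm_encode (A : asm n) : 'M[seq_sub asm_entries]_n :=
  \matrix_(i, j) insubd (SeqSub (mem_head 0 [:: 1; -1])) (A i j).

Definition asm_decode (B : 'M[seq_sub asm_entries]_n) : option (asm n) :=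
  insub (map_mx val B).

Lemma asm_encodeK : pcancel asm_encode asm_decode.
Proof.
move=> A; rewrite /asm_decode; have -> : map_mx val (asm_encode A) = A.
  apply/matrixP => i j; rewrite !mxE insubdK //.
  by case/and3P: (asm_mxP A) => /forallP/(_ i)/forallP/(_ j).
exact: valK.
Qed.

HB.instance Definition _ := isFinite.Build (asm n) (pcan_enumP asm_encodeK).
End AsmFinite.

Section Statistics.
Variables (n : nat) (A : 'M[int]_n).

Definition nu : int :=
  \sum_(i < n) \sum_(i' < n | (i < i')%N)
    \sum_(j < n) \sum_(j' < n | (j' <= j)%N) A i j * A i' j'.

Definition mu : nat := #|[set p : 'I_n * 'I_n | A p.1 p.2 == -1]|.

Definition zeros_left_of_1 (i : 'I_n) : nat :=
  #|[set j | (A i j == 0) && [exists k : 'I_n, (j < k)%N && (A i k == 1)]]|.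
Definition zeros_right_of_1 (i : 'I_n) : nat :=
  #|[set j | (A i j == 0) && [exists k : 'I_n, (k < j)%N && (A i k == 1)]]|.
Definition zeros_above_1 (j : 'I_n) : nat :=
  #|[set i | (A i j == 0) && [exists k : 'I_n, (i < k)%N && (A k j == 1)]]|.
Definition zeros_below_1 (j : 'I_n) : nat :=
  #|[set i | (A i j == 0) && [exists k : 'I_n, (k < i)%N && (A k j == 1)]]|.
End Statistics.

(* The border statistics only make sense for n >= 1; they are set to 0 for
   n = 0. *)
Definition rho_T n : 'M[int]_n -> nat :=
  if n is m.+1 return 'M[int]_n -> nat
  then fun A => zeros_left_of_1 A ord0 else fun=> 0%N.
Definition rho_R n : 'M[int]_n -> nat :=
  if n is m.+1 return 'M[int]_n -> nat
  then fun A => zeros_below_1 A ord_max else fun=> 0%N.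
Definition rho_B n : 'M[int]_n -> nat :=
  if n is m.+1 return 'M[int]_n -> nat
  then fun A => zeros_right_of_1 A ord_max else fun=> 0%N.
Definition rho_L n : 'M[int]_n -> nat :=
  if n is m.+1 return 'M[int]_n -> nat
  then fun A => zeros_above_1 A ord0 else fun=> 0%N.

(* nu is nonnegative on ASMs (nu_ge0 below), so the absolute value in the
   exponent of x is only a cast from int to nat. *)
Definition Zquad (R : comNzRingType) (n : nat) (x y z1 z2 z3 z4 : R) : R :=
  \sum_(A : asm n) x ^+ `|nu A|%N * y ^+ mu A
    * z1 ^+ rho_T A * z2 ^+ rho_R A * z3 ^+ rho_B A * z4 ^+ rho_L A.

Definition Zadj (R : comNzRingType) (n : nat) (x y z1 z2 : R) : R :=
  Zquad n x y z1 1 1 z2.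

Definition Zadj_tilde (R : comNzRingType) (n : nat) (x y z1 z2 : R) : R :=
  Zquad n x y z1 z2 1 1.

Definition Zasm (R : comNzRingType) (n : nat) (x y : R) : R :=
  Zquad n x y 1 1 1 1.

Lemma Zasm0 (R : comNzRingType) (x y : R) : Zasm 0 x y = 1.
Proof.
have asm0 : is_asm (0 : 'M[int]_0).
  by apply/and3P; split; apply/forallP => -[].
rewrite /Zasm /Zquad (big_pred1 (ASM asm0)) /= => [|A]; last first.
  by apply/esym/eqP/val_inj/matrixP => -[].
rewrite /nu /mu big_ord0 (eq_card0 (A := [set _ | _])) ?expr0 ?mulr1 //.
by move=> [[]].
Qed.

(* Here e is the last nonzero entry preceding s in the line. *)
Lemma alternating_prefix_after (e : int) (s : seq int) (k : nat) :
  e \in [:: 1; -1] -> {subset s <= asm_entries} ->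
  path (fun a b => a * b < 0) e [seq a <- s | a != 0] ->
  \sum_(a <- take k s) a \in [:: 0; - e].
Proof.
elim: s e k => [|b s IHs] e [|k] he sub /=; rewrite ?big_nil ?inE ?eqxx //.
have hb : b \in asm_entries by apply: sub; rewrite mem_head.
have {}sub : {subset s <= asm_entries}.
  by move=> a has; apply: sub; rewrite inE has orbT.
rewrite big_cons; have [-> | b0] /= := eqVneq b 0 => [|/andP[eb pb]].
  by move=> pe; have := IHs e k he sub pe; rewrite add0r !inE.
have {}hb : b \in [:: 1; -1] by move: hb; rewrite !inE (negPf b0).
have {eb} Eb : b = - e.
  by move: eb; move: he hb; rewrite !inE => /orP[]/eqP-> /orP[]/eqP->.
move: (IHs b k hb sub pb); rewrite !inE Eb => /orP[]/eqP->.
  by rewrite addr0 eqxx orbT.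
by rewrite opprK addNr eqxx.
Qed.

Lemma alternating_line_prefix (s : seq int) (k : nat) :
  {subset s <= asm_entries} -> alternating_line s ->
  \sum_(a <- take k s) a \in [:: 0; 1].
Proof.
move=> sub /andP[alt /eqP sum1]; apply: (@alternating_prefix_after (-1)) => //.
elim: s sub alt sum1 {k} => [|b s IHs] sub; first by rewrite big_nil.
have hb : b \in asm_entries by apply: sub; rewrite mem_head.
have {}sub : {subset s <= asm_entries}.
  by move=> a has; apply: sub; rewrite inE has orbT.
rewrite big_cons /=; have [-> | b0] := eqVneq b 0.
  by rewrite add0r; apply: IHs.
rewrite /= => pb sum1; rewrite pb andbT.
have {}hb : b \in [:: 1; -1] by move: hb; rewrite !inE (negPf b0).
have := alternating_prefix_after (size s) hb sub pb; rewrite take_size.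
by move: hb sum1; rewrite !inE => /orP[]/eqP-> // + /orP[]/eqP E; rewrite E.
Qed.

Lemma sum_take_codom n (F : 'I_n -> int) (k : nat) :
  \sum_(a <- take k [seq F i | i : 'I_n]) a = \sum_(i < n | (i < k)%N) F i.
Proof.
rewrite -map_take big_map.
rewrite (_ : take k _ = [seq i : 'I_n <- enum 'I_n | (i < k)%N]).
  by rewrite big_filter big_enum_cond.
apply: (inj_map val_inj); rewrite map_take val_enum_ord.
rewrite -(filter_map _ (fun i => i < k)%N) val_enum_ord.
have [le_nk | lt_kn] := leqP n k.
  rewrite take_oversize ?size_iota //; apply/esym/all_filterP/allP => i.
  by rewrite mem_iota => /andP[_ /leq_trans->].
rewrite take_iota (minn_idPl (ltnW lt_kn)) -(subnKC (ltnW lt_kn)) iotaD.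
rewrite filter_cat; set s1 := iota 0 k; set s2 := iota _ _.
have -> : [seq i <- s1 | (i < k)%N] = s1.
  by apply/all_filterP/allP => i; rewrite mem_iota.
have -> : [seq i <- s2 | (i < k)%N] = [::].
  rewrite (eq_in_filter (a2 := pred0)) ?filter_pred0 // => i.
  by rewrite mem_iota leqNgt => /andP[/negPf->].
by rewrite cats0.
Qed.

Lemma nu_ge0 n (A : asm n) : 0 <= nu A.
Proof.
have /and3P[/forallP entA /forallP rowA /forallP colA] := asm_mxP A.
have prefix_ge0 (F : 'I_n -> int) k : {subset codom F <= asm_entries} ->
    alternating_line (codom F) -> 0 <= \sum_(i < n | (i < k)%N) F i.
  move=> subF altF; rewrite -sum_take_codom.
  by have := alternating_line_prefix k subF altF; rewrite !inE => /orP[]/eqP->.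
have -> : nu A = \sum_(i' < n) \sum_(j < n)
    (\sum_(i < n | (i < i')%N) A i j) * (\sum_(j' < n | (j' < j.+1)%N) A i' j').
  rewrite /nu (exchange_big_dep predT) //=; apply: eq_bigr => i' _.
  rewrite exchange_big; apply: eq_bigr => j _.
  by rewrite mulr_suml; apply: eq_bigr => i _; rewrite mulr_sumr.
apply: sumr_ge0 => i' _; apply: sumr_ge0 => j _; apply: mulr_ge0.
  by apply: prefix_ge0 (colA j) => a /codomP[i ->]; exact: (forallP (entA i)).
by apply: prefix_ge0 (rowA i') => a /codomP[j' ->]; exact: (forallP (entA i')).
Qed.

(* Main.v *)
Require Import Defs.
From mathcomp Require Import all_boot all_order all_algebra.
From mathcomp Require Import ring zify.
From mathcomp Require Import mpoly.

(* ASMs are the states of the six-vertex model with domain-wall boundary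
   conditions. Attach a parameter z_i to row i and w_j to column j. Let r and s
   be the sums (0 or 1) of the entries to the left of and above a zero; give
   this zero the weight A(z_i,w_j) = y z_i w_j - (z_i-1)(w_j-1) if r = s = 0, x
   times that if r = s = 1, and B(z_i,w_j) = y - x(z_i-1)(w_j-1) if r <> s.
   Give a 1 the weight 1 and a -1 the weight y f(z_i) f(w_j), f(z) =
   (xz-1)(z-1) + yz. These weights satisfy the Yang-Baxter equation, so the
   partition function W(z;w) is symmetric in the z_i; as a polynomial in w_0 it
   has small degree and it factors when A(z_i,w_0) = 0, which by interpolation
   gives the Izergin-Korepin formula: W is, up to explicit products, the
   determinant of 1 / (A(z_i,w_j) B(z_i,w_j)). Desnanot-Jacobi then yields a
   quadratic identity between W and its four corner minors. The theorem is this
   identity at z = (z1,1,...,1,z3), w = (z4,1,...,1,z2): since A(1,1) = B(1,1)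
   = y, A(z,1) = y z and B(z,1) = y, the weights there are, up to a power of y,
   those of the refined generating function except at the four corners, and
   splitting according to which corners hold a 1 produces the lower-order
   terms. *)

Set Implicit Arguments.
Unset Strict Implicit.
Unset Printing Implicit Defensive.

Import Order.TTheory GRing.Theory Num.Theory.
Local Open Scope ring_scope.

(** The determinant formula degenerates exactly where the theorem lives: as soon as two parameters
    equal 1, the Vandermonde products and the determinant vanish. Izergin-Korepin and
    Desnanot-Jacobi are therefore applied only to distinct indeterminates over [int], inside a
    fraction field. Once the Vandermonde products of the corner minors are cancelled, a polynomial
    identity between weighted sums is left, and this can be evaluated in every commutative ring. The
    same passage is made a second time at the end, because the corner corrections are quotients such
    as A(z1,z4) / (y z1 z4). One elementary fact is used twice: if the weight of a zero in a corner
    is 0, only ASMs with a 1 in this corner survive, and the sum factors through the next smaller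
    size. It gives the values at the interpolation nodes and also the lower-order terms of the
    theorem, since a sum in which the zero weight of one corner carries a factor t is affine in
    t. *)

Lemma path_of_prefix_sums (e : int) (s : seq int) :
  e \in [:: 1; -1] ->
  (forall k, (e == 1)%:R + \sum_(a <- take k s) a \in [:: 0; 1 : int]) ->
  path (fun a b => a * b < 0) e [seq a <- s | a != 0].
Proof.
elim: s e => [|b s IHs] e he //= pre.
have pre' k : (e == 1)%:R + b + \sum_(a <- take k s) a \in [:: 0; 1 : int].
  by have := pre k.+1; rewrite /= big_cons addrA.
have := pre' 0%N; rewrite take0 big_nil addr0.
have [b0 _|b0] := eqVneq b 0.
  by apply: IHs => // k; have := pre' k; rewrite b0 addr0.
move: he pre' b0; rewrite !inE => /orP[]/eqP-> /= pre' b0 hb.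
  have Eb : b = -1 by move: hb b0; lia.
  rewrite Eb /=; apply: IHs => // k.
  by have := pre' k; rewrite Eb subrr.
have Eb : b = 1 by move: hb b0; lia.
rewrite Eb /=; apply: IHs => // k.
by have := pre' k; rewrite Eb.
Qed.

Lemma alternating_line_of_prefix_sums (s : seq int) :
  (forall k, \sum_(a <- take k s) a \in [:: 0; 1]) -> \sum_(a <- s) a = 1 ->
  alternating_line s.
Proof.
move=> pre tot; rewrite /alternating_line tot eqxx andbT.
(* An imaginary -1 in front of the line plays the last nonzero entry. The term [(e == 1)%:R] is the
   running total right after [e], here 0. *)
apply: (@path_sorted _ _ (-1)); apply: path_of_prefix_sums => // k.
by rewrite add0r.
Qed.

(** * ASMs through prefix sums *)

Section PrefixSums.
Variable n : nat.
Implicit Type A : 'M[int]_n.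

Definition row_prefix A (i : 'I_n) (k : nat) := \sum_(j < n | (j < k)%N) A i j.
Definition col_prefix A (k : nat) (j : 'I_n) := \sum_(i < n | (i < k)%N) A i j.

Lemma row_prefix_tr A i k : row_prefix A^T i k = col_prefix A k i.
Proof. by apply: eq_bigr => j _; rewrite mxE. Qed.

Lemma col_prefix_tr A i k : col_prefix A^T k i = row_prefix A i k.
Proof. by apply: eq_bigr => j _; rewrite mxE. Qed.

Lemma row_prefix0 A i : row_prefix A i 0 = 0.
Proof. by rewrite /row_prefix big_pred0. Qed.

Lemma row_prefixS A i (j : 'I_n) :
  row_prefix A i j.+1 = row_prefix A i j + A i j.
Proof.
rewrite /row_prefix (bigD1 j) //= addrC; congr (_ + _).
by apply: eq_bigl => k; rewrite ltnS [RHS]ltn_neqAle andbC.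
Qed.

Lemma row_prefix_full A i k : (n <= k)%N -> row_prefix A i k = \sum_j A i j.
Proof.
by move=> nk; apply: eq_bigl => j; rewrite (leq_trans (ltn_ord j) nk).
Qed.

Lemma is_asm_tr A : is_asm A^T = is_asm A.
Proof.
have line (F G : 'I_n -> 'I_n -> int) : F =2 G ->
    [forall i, alternating_line [seq F i j | j : 'I_n]] =
    [forall i, alternating_line [seq G i j | j : 'I_n]].
  by move=> FG; apply: eq_forallb => i; rewrite (eq_image (fun=> erefl) (FG i)).
rewrite /is_asm (line (A^T) (fun i j => A j i)); last by move=> i j; rewrite mxE.
rewrite (line (fun i j => A^T j i) A); last by move=> i j; rewrite mxE.
rewrite [X in _ && X]andbC; congr (_ && _).
apply/forallP/forallP => H i; apply/forallP => j.
  by have /forallP/(_ i) := H j; rewrite mxE.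
by rewrite mxE; have /forallP/(_ i) := H j.
Qed.

(** Bounds on prefix sums replace sign alternation: they are stable under transposition, reflection
    and removal of a frozen border, and the prefix sums are the edge variables of the six-vertex
    model. *)
Lemma asmP A : reflect
  [/\ forall i k, row_prefix A i k \in [:: 0; 1], forall i, \sum_j A i j = 1,
      forall k j, col_prefix A k j \in [:: 0; 1]
    & forall j, \sum_i A i j = 1] (is_asm A).
Proof.
have tot (F : 'I_n -> int) : \sum_(a <- [seq F i | i : 'I_n]) a = \sum_i F i.
  by rewrite big_map big_enum.
apply: (iffP and3P) => [[/forallP ent /forallP rows /forallP cols]|].
  have line (F : 'I_n -> int) k : (forall i, F i \in asm_entries) ->
      alternating_line [seq F i | i : 'I_n] ->
      \sum_(i < n | (i < k)%N) F i \in [:: 0; 1].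
    move=> hF; rewrite -sum_take_codom; apply: alternating_line_prefix.
    by move=> a /codomP[i ->].
  have {}ent i j : A i j \in asm_entries by apply: (forallP (ent i)).
  split=> [i k|i|k j|j].
  - exact: line.
  - by have /andP[_ /eqP] := rows i; rewrite tot.
  - exact: line.
  - by have /andP[_ /eqP] := cols j; rewrite tot.
case=> [rp rt cp ct]; split; apply/forallP => i; last 2 first.
- apply: alternating_line_of_prefix_sums => [k|]; last by rewrite tot.
  by rewrite sum_take_codom; apply: rp.
- apply: alternating_line_of_prefix_sums => [k|]; last by rewrite tot.
  by rewrite sum_take_codom; apply: cp.
apply/forallP => j; have := rp i j.+1; rewrite row_prefixS.
by move: (rp i j); rewrite !inE => /orP[]/eqP-> ; lia.
Qed.

End PrefixSums.

Lemma col_prefix0 n (A : 'M[int]_n) j : col_prefix A 0 j = 0.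
Proof. by rewrite -row_prefix_tr row_prefix0. Qed.

Lemma col_prefixS n (A : 'M[int]_n) (i : 'I_n) j :
  col_prefix A i.+1 j = col_prefix A i j + A i j.
Proof. by rewrite -!row_prefix_tr row_prefixS mxE. Qed.

Lemma col_prefix_full n (A : 'M[int]_n) k j :
  (n <= k)%N -> col_prefix A k j = \sum_i A i j.
Proof.
by move=> nk; rewrite -row_prefix_tr row_prefix_full //; apply: eq_bigr => i _;
  rewrite mxE.
Qed.

Section AsmFacts.
Variables (n : nat) (A : asm n).

Lemma asm_row_prefix i k : row_prefix A i k \in [:: 0; 1].
Proof. by have [] := asmP _ (asm_mxP A). Qed.

Lemma asm_col_prefix k j : col_prefix A k j \in [:: 0; 1].
Proof. by have [] := asmP _ (asm_mxP A). Qed.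

Lemma asm_row_sum i : \sum_j A i j = 1.
Proof. by have [] := asmP _ (asm_mxP A). Qed.

Lemma asm_col_sum j : \sum_i A i j = 1.
Proof. by have [] := asmP _ (asm_mxP A). Qed.

Lemma asm_entry i j : A i j \in asm_entries.
Proof. by have /and3P[/forallP/(_ i)/forallP/(_ j)] := asm_mxP A. Qed.

End AsmFacts.

Lemma asm_inj n (A B : asm n) : A = B :> 'M[int]_n -> A = B.
Proof. exact: val_inj. Qed.

Lemma big_image_asm n m (S : nmodType) (P : pred (asm m)) (h : asm n -> asm m)
    (F : asm m -> S) :
  injective h -> (forall A, reflect (exists B, A = h B) (P A)) ->
  \sum_(A | P A) F A = \sum_B F (h B).
Proof.
move=> inj_h hP; transitivity (\sum_(A in h @: [set: asm n]) F A).
  apply: eq_bigl => A; apply/hP/imsetP => -[B]; first by move=> ->; exists B.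
  by move=> _ ->; exists B.
by rewrite big_imset; [apply: eq_bigl => B; rewrite inE | apply: in2W].
Qed.

(** * Weighted sums over ASMs and their symmetries *)

Section Weights.
Variable R : comNzRingType.

(* [r] and [s] are the sums of the entries to the left of and above the entry
   [e]; [a1], [a2], [b1], [b2] weigh a zero with (r, s) = (0, 0), (1, 1), (1, 0),
   (0, 1). *)
Definition entry_weight (a1 a2 b1 b2 c : R) (r s e : int) : R :=
  if e == 1 then 1 else if e == 0 then
    (if r == 0 then (if s == 0 then a1 else b2) else
     (if s == 0 then b1 else a2)) else c.

Definition asm_weight n (a1 a2 b1 b2 c : 'I_n -> 'I_n -> R) (A : 'M[int]_n) :=
  \prod_i \prod_j entry_weight (a1 i j) (a2 i j) (b1 i j) (b2 i j) (c i j)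
    (row_prefix A i j) (col_prefix A i j) (A i j).

Definition asm_sum n (a1 a2 b1 b2 c : 'I_n -> 'I_n -> R) : R :=
  \sum_(A : asm n) asm_weight a1 a2 b1 b2 c A.

Lemma eq_asm_sum n (a1 a2 b1 b2 c a1' a2' b1' b2' c' : 'I_n -> 'I_n -> R) :
  a1 =2 a1' -> a2 =2 a2' -> b1 =2 b1' -> b2 =2 b2' -> c =2 c' ->
  asm_sum a1 a2 b1 b2 c = asm_sum a1' a2' b1' b2' c'.
Proof.
move=> E1 E2 E3 E4 E5; apply: eq_bigr => A _; apply: eq_bigr => i _.
by apply: eq_bigr => j _; rewrite E1 E2 E3 E4 E5.
Qed.

Lemma asm_tr_subproof n (A : asm n) : is_asm (A : 'M[int]_n)^T.
Proof. by rewrite is_asm_tr; apply: asm_mxP. Qed.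

Definition asm_tr n (A : asm n) := ASM (asm_tr_subproof A).

Lemma asm_trK n : involutive (@asm_tr n).
Proof. by move=> A; apply: asm_inj; rewrite /= trmxK. Qed.

Lemma asm_sum_tr n (a1 a2 b1 b2 c : 'I_n -> 'I_n -> R) :
  asm_sum a1 a2 b1 b2 c =
  asm_sum (fun i j => a1 j i) (fun i j => a2 j i)
          (fun i j => b2 j i) (fun i j => b1 j i) (fun i j => c j i).
Proof.
rewrite /asm_sum (reindex_inj (inv_inj (@asm_trK n))); apply: eq_bigr => A _.
rewrite /asm_weight exchange_big /=; apply: eq_bigr => i _; apply: eq_bigr => j _.
rewrite row_prefix_tr col_prefix_tr mxE /entry_weight.
by case: ifP => // _; case: ifP => // _; do 2!case: ifP.
Qed.

Definition flip_mx n (A : 'M[int]_n) : 'M[int]_n := \matrix_(i, j) A i (rev_ord j).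

Lemma row_prefix_flip n (A : 'M[int]_n) i k : (k <= n)%N ->
  row_prefix (flip_mx A) i k = \sum_j A i j - row_prefix A i (n - k).
Proof.
move=> kn; rewrite /row_prefix (reindex_inj rev_ord_inj) /=.
rewrite [X in _ = X - _](bigID (fun j : 'I_n => (j < n - k)%N)) /= [RHS]addrC addKr.
apply: eq_big => [j|j _]; last by rewrite mxE rev_ordK.
by have := ltn_ord j; lia.
Qed.

Lemma col_prefix_flip n (A : 'M[int]_n) k j :
  col_prefix (flip_mx A) k j = col_prefix A k (rev_ord j).
Proof. by apply: eq_bigr => i _; rewrite mxE. Qed.

Lemma asm_flip_subproof n (A : asm n) : is_asm (flip_mx A).
Proof.
have [rp rt cp ct] := asmP _ (asm_mxP A); apply/asmP; split=> [i k|i|k j|j].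
- have [kn|/ltnW nk] := leqP k n.
    rewrite row_prefix_flip // rt; have := rp i (n - k)%N.
    by rewrite !inE => /orP[]/eqP->.
  rewrite row_prefix_full // (reindex_inj rev_ord_inj) /=.
  under eq_bigr => j _ do rewrite mxE rev_ordK.
  by rewrite rt.
- rewrite (reindex_inj rev_ord_inj) /=.
  by under eq_bigr => j _ do rewrite mxE rev_ordK; rewrite rt.
- by rewrite col_prefix_flip.
- by under eq_bigr => i _ do rewrite mxE; rewrite ct.
Qed.

Definition asm_flip n (A : asm n) := ASM (asm_flip_subproof A).

Lemma asm_flipK n : involutive (@asm_flip n).
Proof. by move=> A; apply/asm_inj/matrixP => i j; rewrite !mxE rev_ordK. Qed.

(** The entries to the right of a zero sum to one minus the sum on its left, so a reflection toggles
    [r] and keeps [s]: it exchanges [a1] with [b1] and [a2] with [b2]. *)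
Lemma asm_sum_flip n (a1 a2 b1 b2 c : 'I_n -> 'I_n -> R) :
  asm_sum a1 a2 b1 b2 c =
  asm_sum (fun i j => b1 i (rev_ord j)) (fun i j => b2 i (rev_ord j))
          (fun i j => a1 i (rev_ord j)) (fun i j => a2 i (rev_ord j))
          (fun i j => c i (rev_ord j)).
Proof.
rewrite /asm_sum (reindex_inj (inv_inj (@asm_flipK n))); apply: eq_bigr => A _.
apply: eq_bigr => i _; rewrite (reindex_inj rev_ord_inj); apply: eq_bigr => j _.
rewrite /= row_prefix_flip ?leq_subr // col_prefix_flip mxE rev_ordK asm_row_sum.
have -> : (n - (n - j.+1))%N = j.+1 by have := ltn_ord j; lia.
rewrite row_prefixS /entry_weight; case: ifP => // _; case: eqP => [->|//].
rewrite addr0; have := asm_row_prefix A i j; rewrite !inE.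
by case/orP => /eqP->; case: ifP.
Qed.

End Weights.

(** * Freezing a corner *)

Definition corner_mx n (B : 'M[int]_n) : 'M[int]_n.+1 :=
  \matrix_(i, j) match unlift ord0 i, unlift ord0 j with
    | Some i', Some j' => B i' j'
    | None, None => 1
    | _, _ => 0
    end.

Section Corner.
Variables (n : nat) (B : 'M[int]_n).

Lemma corner_mx00 : corner_mx B ord0 ord0 = 1.
Proof. by rewrite mxE unlift_none. Qed.

Lemma corner_mx0l j : corner_mx B ord0 (lift ord0 j) = 0.
Proof. by rewrite mxE unlift_none liftK. Qed.

Lemma corner_mxl0 i : corner_mx B (lift ord0 i) ord0 = 0.
Proof. by rewrite mxE unlift_none liftK. Qed.

Lemma corner_mxll i j : corner_mx B (lift ord0 i) (lift ord0 j) = B i j.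
Proof. by rewrite mxE !liftK. Qed.

End Corner.

Lemma corner_mx_tr n (B : 'M[int]_n) : (corner_mx B)^T = corner_mx B^T.
Proof.
apply/matrixP => i j; rewrite [LHS]mxE.
case: (unliftP ord0 i) => [i'|] ->; case: (unliftP ord0 j) => [j'|] ->;
  by rewrite !(corner_mxll, corner_mx0l, corner_mxl0, corner_mx00) ?mxE.
Qed.

Lemma sum_ord_ltS n (F : 'I_n.+1 -> int) k :
  \sum_(j < n.+1 | (j < k.+1)%N) F j =
  F ord0 + \sum_(j < n | (j < k)%N) F (lift ord0 j).
Proof. by rewrite big_mkcond big_ord_recl /= [in RHS]big_mkcond. Qed.

Lemma row_prefix_recl n (A : 'M[int]_n.+1) i k :
  row_prefix A i k.+1 = A i ord0 + \sum_(j < n | (j < k)%N) A i (lift ord0 j).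
Proof. exact: sum_ord_ltS. Qed.

Lemma row_prefix_corner0 n (B : 'M[int]_n) k :
  row_prefix (corner_mx B) ord0 k = (0 < k)%N%:R.
Proof.
case: k => [|k]; first by rewrite row_prefix0.
rewrite row_prefix_recl corner_mx00 big1 ?addr0 // => j _.
exact: corner_mx0l.
Qed.

Lemma row_prefix_corner n (B : 'M[int]_n) i k :
  row_prefix (corner_mx B) (lift ord0 i) k = row_prefix B i k.-1.
Proof.
case: k => [|k]; first by rewrite !row_prefix0.
rewrite row_prefix_recl corner_mxl0 add0r.
by apply: eq_bigr => j _; rewrite corner_mxll.
Qed.

Lemma col_prefix_corner0 n (B : 'M[int]_n) k :
  col_prefix (corner_mx B) k ord0 = (0 < k)%N%:R.
Proof. by rewrite -row_prefix_tr corner_mx_tr row_prefix_corner0. Qed.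

Lemma col_prefix_corner n (B : 'M[int]_n) k j :
  col_prefix (corner_mx B) k (lift ord0 j) = col_prefix B k.-1 j.
Proof. by rewrite -!row_prefix_tr corner_mx_tr row_prefix_corner. Qed.

Lemma asm_corner_subproof n (B : asm n) : is_asm (corner_mx B).
Proof.
have [rp rt cp ct] := asmP _ (asm_mxP B); apply/asmP; split=> [i k|i|k j|j].
- case: (unliftP ord0 i) => [i'|] ->; first by rewrite row_prefix_corner.
  by rewrite row_prefix_corner0; case: k.
- rewrite -(row_prefix_full _ _ (leqnn n.+1)).
  case: (unliftP ord0 i) => [i'|] ->; last by rewrite row_prefix_corner0.
  by rewrite row_prefix_corner row_prefix_full.
- case: (unliftP ord0 j) => [j'|] ->; first by rewrite col_prefix_corner.
  by rewrite col_prefix_corner0; case: k.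
rewrite -(col_prefix_full _ _ (leqnn n.+1)).
case: (unliftP ord0 j) => [j'|] ->; last by rewrite col_prefix_corner0.
by rewrite col_prefix_corner col_prefix_full.
Qed.

Definition asm_corner n (B : asm n) := ASM (asm_corner_subproof B).

Lemma asm_corner_inj n : injective (@asm_corner n).
Proof.
move=> A B /(congr1 (@asm_mx _)) /= /matrixP E; apply/asm_inj/matrixP => i j.
by have := E (lift ord0 i) (lift ord0 j); rewrite !corner_mxll.
Qed.

Lemma asm_row0_ge0 n (A : asm n.+1) j : 0 <= A ord0 j.
Proof.
have := asm_col_prefix A 1 j.
by rewrite -[1%N]/(@ord0 n).+1 col_prefixS col_prefix0 add0r !inE => /orP[]/eqP->.
Qed.

Lemma asm_row0_corner n (A : asm n.+1) j :
  A ord0 ord0 = 1 -> A ord0 (lift ord0 j) = 0.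
Proof.
move=> A00; have := asm_row_sum A ord0; rewrite big_ord_recl A00 => E.
have /eqP : \sum_(k < n) A ord0 (lift ord0 k) = 0.
  by apply: (addrI 1); rewrite E addr0.
rewrite psumr_eq0 => [/allP/(_ j (mem_index_enum _))/eqP //|k _].
exact: asm_row0_ge0.
Qed.

Lemma asm_cornerP n (A : asm n.+1) :
  reflect (exists B, A = asm_corner B) (A ord0 ord0 == 1).
Proof.
apply: (iffP eqP) => [A00|[B ->]]; last exact: corner_mx00.
pose B : 'M[int]_n := \matrix_(i, j) A (lift ord0 i) (lift ord0 j).
have col0 i : A (lift ord0 i) ord0 = 0.
  have := @asm_row0_corner _ (asm_tr A) i; rewrite /= !mxE; exact.
have EA : A = corner_mx B :> 'M_n.+1.
  apply/matrixP => i j.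
  case: (unliftP ord0 i) => [i'|] ->; case: (unliftP ord0 j) => [j'|] ->;
  rewrite ?corner_mxll ?corner_mx0l ?corner_mxl0 ?corner_mx00 ?mxE //.
  exact: asm_row0_corner.
have [rp rt cp ct] := asmP _ (asm_mxP A).
have Basm : is_asm B.
  apply/asmP; split=> [i k|i|k j|j].
  - by have := rp (lift ord0 i) k.+1; rewrite EA row_prefix_corner.
  - have := rt (lift ord0 i); rewrite EA -(row_prefix_full _ _ (leqnn n.+1)).
    by rewrite row_prefix_corner row_prefix_full.
  - by have := cp k.+1 (lift ord0 j); rewrite EA col_prefix_corner.
  have := ct (lift ord0 j); rewrite EA -(col_prefix_full _ _ (leqnn n.+1)).
  by rewrite col_prefix_corner col_prefix_full.
by exists (ASM Basm); apply: asm_inj.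
Qed.

Section CornerWeights.
Variable R : comNzRingType.

Definition lift2 n (i0 j0 : 'I_n.+1) (a : 'I_n.+1 -> 'I_n.+1 -> R) (i j : 'I_n) :=
  a (lift i0 i) (lift j0 j).

(** Below and to the right of the corner 1 the border consists of zeros, of type (1, 0) in the first
    row and (0, 1) in the first column. Removing both leaves the prefix sums of the remaining
    entries unchanged. *)
Lemma asm_weight_corner n (a1 a2 b1 b2 c : 'I_n.+1 -> 'I_n.+1 -> R) (B : asm n) :
  asm_weight a1 a2 b1 b2 c (asm_corner B) =
  (\prod_j b1 ord0 (lift ord0 j)) * (\prod_i b2 (lift ord0 i) ord0) *
  asm_weight (lift2 ord0 ord0 a1) (lift2 ord0 ord0 a2) (lift2 ord0 ord0 b1)
             (lift2 ord0 ord0 b2) (lift2 ord0 ord0 c) B.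
Proof.
rewrite /asm_weight big_ord_recl -mulrA -big_split /=; congr (_ * _).
  rewrite big_ord_recl corner_mx00 /entry_weight eqxx mul1r.
  apply: eq_bigr => j _; rewrite corner_mx0l row_prefix_corner0 col_prefix0.
  by rewrite eqxx.
apply: eq_bigr => i _; rewrite big_ord_recl; congr (_ * _).
  by rewrite corner_mxl0 row_prefix0 col_prefix_corner0 /entry_weight eqxx.
apply: eq_bigr => j _.
by rewrite corner_mxll row_prefix_corner col_prefix_corner.
Qed.

(** The corner entry is 0 or 1 and has [r = s = 0], so [a1 ord0 ord0] is a factor of exactly those
    weights whose ASM has no 1 in the corner. *)
Lemma asm_sum_corner0 n (a1 a2 b1 b2 c : 'I_n.+1 -> 'I_n.+1 -> R) :
  a1 ord0 ord0 = 0 ->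
  asm_sum a1 a2 b1 b2 c =
  (\prod_j b1 ord0 (lift ord0 j)) * (\prod_i b2 (lift ord0 i) ord0) *
  asm_sum (lift2 ord0 ord0 a1) (lift2 ord0 ord0 a2) (lift2 ord0 ord0 b1)
          (lift2 ord0 ord0 b2) (lift2 ord0 ord0 c).
Proof.
move=> a0; rewrite /asm_sum (bigID (fun A : asm n.+1 => A ord0 ord0 == 1)) /=.
rewrite [X in _ + X]big1 ?addr0 => [|A A00].
  rewrite (big_image_asm _ (@asm_corner_inj n)); last exact: asm_cornerP.
  by rewrite mulr_sumr; apply: eq_bigr => B _; rewrite asm_weight_corner.
rewrite /asm_weight big_ord_recl big_ord_recl /entry_weight (negPf A00).
rewrite row_prefix0 col_prefix0 eqxx a0; case: eqP => [|A00']; first by rewrite !mul0r.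
have := asm_row0_ge0 A ord0; have := asm_entry A ord0 ord0; rewrite !inE.
by move: A00 A00'; lia.
Qed.

Definition scale_at n (i0 j0 : 'I_n) (t : R) (a : 'I_n -> 'I_n -> R) (i j : 'I_n) :=
  (if (i == i0) && (j == j0) then t else 1) * a i j.

(* The corner entry is 0 or 1 and only its zero weight carries [t]. *)
Lemma asm_sum_affine n t (a1 a2 b1 b2 c : 'I_n.+1 -> 'I_n.+1 -> R) :
  asm_sum (scale_at ord0 ord0 t a1) a2 b1 b2 c =
  t * asm_sum a1 a2 b1 b2 c + (1 - t) * asm_sum (scale_at ord0 ord0 0 a1) a2 b1 b2 c.
Proof.
rewrite /asm_sum !mulr_sumr -big_split; apply: eq_bigr => A _ /=.
pose w (i j : 'I_n.+1) := entry_weight (a1 i j) (a2 i j) (b1 i j) (b2 i j) (c i j)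
  (row_prefix A i j) (col_prefix A i j) (A i j).
have E s : asm_weight (scale_at ord0 ord0 s a1) a2 b1 b2 c A =
    entry_weight (s * a1 ord0 ord0) 0 0 0 (c ord0 ord0) 0 0 (A ord0 ord0) *
    ((\prod_(j < n) w ord0 (lift ord0 j)) *
     \prod_(i < n) \prod_(j < n.+1) w (lift ord0 i) j).
  rewrite /asm_weight big_ord_recl big_ord_recl row_prefix0 col_prefix0 -mulrA.
  rewrite /scale_at eqxx /=.
  congr (_ * (_ * _)); first by apply: eq_bigr => j _; rewrite mul1r.
  by apply: eq_bigr => i _; apply: eq_bigr => j _; rewrite mul1r.
have -> : asm_weight a1 a2 b1 b2 c A = asm_weight (scale_at ord0 ord0 1 a1) a2 b1 b2 c A.
  by apply: eq_bigr => i _; apply: eq_bigr => j _; rewrite /scale_at if_same mul1r.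
rewrite !E; set W := (_ * \prod_(i < n) _).
by rewrite /entry_weight !eqxx; case: ifP => _; last case: ifP => _; ring.
Qed.

Lemma asm_sum_scale_TL n t (a1 a2 b1 b2 c : 'I_n.+1 -> 'I_n.+1 -> R) :
  asm_sum (scale_at ord0 ord0 t a1) a2 b1 b2 c =
  t * asm_sum a1 a2 b1 b2 c +
  (1 - t) * ((\prod_j b1 ord0 (lift ord0 j)) * (\prod_i b2 (lift ord0 i) ord0) *
  asm_sum (lift2 ord0 ord0 a1) (lift2 ord0 ord0 a2) (lift2 ord0 ord0 b1)
          (lift2 ord0 ord0 b2) (lift2 ord0 ord0 c)).
Proof.
rewrite asm_sum_affine; congr (_ + _ * _); rewrite asm_sum_corner0; last first.
  by rewrite /scale_at eqxx mul0r.
by congr (_ * _); apply: eq_asm_sum => // i j; rewrite /lift2 /scale_at mul1r.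
Qed.

(** Counting zeros once and -1's twice means summing [1 - A i j], which gives n^2 - n for every ASM;
    this is why the weight of a -1 is scaled by the square. *)
Lemma asm_sum_scale n k (a1 a2 b1 b2 c : 'I_n -> 'I_n -> R) :
  asm_sum (fun i j => k * a1 i j) (fun i j => k * a2 i j)
    (fun i j => k * b1 i j) (fun i j => k * b2 i j) (fun i j => k ^+ 2 * c i j)
  = k ^+ (n * n - n) * asm_sum a1 a2 b1 b2 c.
Proof.
rewrite /asm_sum mulr_sumr; apply: eq_bigr => A _.
have ent i j := asm_entry A i j.
transitivity (\prod_i \prod_j (k ^+ absz (1 - A i j) *
   entry_weight (a1 i j) (a2 i j) (b1 i j) (b2 i j) (c i j)
    (row_prefix A i j) (col_prefix A i j) (A i j))).
  apply: eq_bigr => i _; apply: eq_bigr => j _; rewrite /entry_weight.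
  have := ent i j; rewrite !inE => /or3P[]/eqP-> /=; rewrite ?subrr ?mul1r //.
  by do 2!case: ifP.
under eq_bigr => i _ do rewrite big_split /= -expr_sum.
rewrite big_split /= -expr_sum; congr (_ ^+ _ * _).
apply/eqP; rewrite -eqz_nat; apply/eqP.
have absE i j : (absz (1 - A i j))%:Z = 1 - A i j.
  by have := ent i j; rewrite !inE => /or3P[]/eqP->.
have sumZ (I : finType) (F : I -> nat) : (\sum_i F i)%N%:Z = \sum_i (F i)%:Z.
  by rewrite (big_morph _ PoszD (erefl _)).
rewrite sumZ.
under eq_bigr => i _.
  rewrite sumZ; under eq_bigr => j _ do rewrite absE.
  rewrite sumrB asm_row_sum sumr_const card_ord; over.
rewrite sumr_const card_ord -mulr_natr; case: (n) => [|m]; first by rewrite mulr0.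
by rewrite !natz; lia.
Qed.

End CornerWeights.

(** * Inhomogeneous six-vertex weights and row exchange *)

Section SixVertex.
Variables (R : comNzRingType) (x y : R).

Definition wA (z w : R) := y * z * w - (z - 1) * (w - 1).
Definition wB (z w : R) := y - x * (z - 1) * (w - 1).
(** The choice of [wf] keeps the anisotropy of the model constant: [y * wf z * wf w] equals [x * wA
    z w ^+ 2 + wB z w ^+ 2 - (x + 1 - y) * wA z w * wB z w]. *)
Definition wf (z : R) := (x * z - 1) * (z - 1) + y * z.

Definition spectral_sum n (z w : 'I_n -> R) : R :=
  asm_sum (fun i j => wA (z i) (w j)) (fun i j => x * wA (z i) (w j))
          (fun i j => wB (z i) (w j)) (fun i j => wB (z i) (w j))
          (fun i j => y * wf (z i) * wf (w j)).

Lemma eq_spectral_sum n (z w z' w' : 'I_n -> R) :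
  z =1 z' -> w =1 w' -> spectral_sum z w = spectral_sum z' w'.
Proof. by move=> Ez Ew; apply: eq_asm_sum => i j; rewrite Ez Ew. Qed.

(* [r] is the horizontal edge on the left, [c] and [d] the vertical edges above
   and below; the right edge [r (+) c (+) d] is determined by them. *)
Definition vertex (z w : R) (r c d : bool) : R :=
  match r, c, d with
  | false, false, false => wA z w
  | false, false, true => 1
  | false, true, true => wB z w
  | true, false, false => wB z w
  | true, true, true => x * wA z w
  | true, true, false => y * wf z * wf w
  | _, _, _ => 0
  end.

(** A row of the transfer matrix: given the vertical edges, the horizontal ones are forced. The
    final [r%:R], like the final [all id c] of [rows_sum], imposes a domain-wall boundary value. *)
Fixpoint row_sum z (ws : seq R) (c d : seq bool) (r : bool) : R :=
  match ws, c, d with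
  | [::], [::], [::] => r%:R
  | w :: ws', c0 :: c', d0 :: d' =>
      vertex z w r c0 d0 * row_sum z ws' c' d' (r (+) c0 (+) d0)
  | _, _, _ => 0
  end.

Fixpoint rows_sum n (zs ws : seq R) (c : seq bool) : R :=
  if zs is z :: zs' then
    \sum_(d : n.-tuple bool) row_sum z ws c d false * rows_sum n zs' ws d
  else (all id c)%:R.

Lemma sum_tuple_cons n (T : finType) (S : nmodType) (F : seq T -> S) :
  \sum_(t : n.+1.-tuple T) F t = \sum_a \sum_(t : n.-tuple T) F (a :: t).
Proof.
rewrite pair_big /= (reindex (fun p : T * n.-tuple T => cons_tuple p.1 p.2)) //=.
exists (fun t => (thead t, [tuple of behead t])) => [[a t] _|t _] /=.
  by congr pair; apply: val_inj.
by case/tupleP: t => a t; apply: val_inj.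
Qed.

Definition rows2_sum n z z' ws c d r1 r2 : R :=
  \sum_(e : n.-tuple bool) row_sum z ws c e r1 * row_sum z' ws e d r2.

Lemma rows2_sum_cons n z z' w ws c0 c d0 d r1 r2 :
  rows2_sum n.+1 z z' (w :: ws) (c0 :: c) (d0 :: d) r1 r2 =
  \sum_(e0 : bool) vertex z w r1 c0 e0 * vertex z' w r2 e0 d0 *
     rows2_sum n z z' ws c d (r1 (+) c0 (+) e0) (r2 (+) e0 (+) d0).
Proof.
rewrite /rows2_sum (sum_tuple_cons _ (fun e => row_sum z (w :: ws) (c0 :: c) e r1 *
  row_sum z' (w :: ws) e (d0 :: d) r2)); apply: eq_bigr => e0 _.
by rewrite mulr_sumr; apply: eq_bigr => e _ /=; rewrite mulrACA.
Qed.

(* The diagonal entry of the R-matrix [Rmx] below on the states 00 and 11; on the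
   span of 01 and 10 that matrix is [[wf z, x (z - z')], [z - z', wf z']]. *)
Definition wd (z z' : R) := y * z' + x * (z - 1) * z' - (z' - 1).

Definition Rmx (z z' : R) (v : bool -> bool -> R) (r1 r2 : bool) : R :=
  match r1, r2 with
  | false, true => wf z * v false true + x * (z - z') * v true false
  | true, false => (z - z') * v false true + wf z' * v true false
  | _, _ => wd z z' * v r1 r2
  end.

(** The functions [v] and [v'] stand for the two-row sums over the columns further right, in the two
    orders of the rows. A finite check carries the R-matrix through one more column; the factor
    [wd z z'] is kept on the left to avoid a division. *)
Lemma yang_baxter z z' w c0 d0 (v v' : bool -> bool -> R) r1 r2 :
  (forall r1 r2, wd z z' * v' r1 r2 = Rmx z z' v r1 r2) ->
  wd z z' * \sum_(e : bool) vertex z' w r1 c0 e * vertex z w r2 e d0 *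
     v' (r1 (+) c0 (+) e) (r2 (+) e (+) d0) =
  Rmx z z' (fun s1 s2 => \sum_(e : bool) vertex z w s1 c0 e * vertex z' w s2 e d0 *
     v (s1 (+) c0 (+) e) (s2 (+) e (+) d0)) r1 r2.
Proof.
move=> IH; rewrite mulr_sumr; under eq_bigr => e _ do rewrite mulrCA IH.
by case: r1; case: r2; case: c0; case: d0; rewrite /= !big_bool /= /wA /wB /wf /wd;
  ring.
Qed.

Lemma rows2_exchange n z z' ws c d r1 r2 :
  size ws = n -> size c = n -> size d = n ->
  wd z z' * rows2_sum n z' z ws c d r1 r2 = Rmx z z' (rows2_sum n z z' ws c d) r1 r2.
Proof.
elim: n ws c d r1 r2 => [|n IHn] [|w ws] [|c0 c] [|d0 d] //= r1 r2.
  move=> _ _ _; have E u u' s1 s2 :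
      rows2_sum 0 u u' [::] [::] [::] s1 s2 = s1%:R * s2%:R.
    by rewrite /rows2_sum /= (big_pred1 [tuple]) // => t; apply/esym/eqP/tuple0.
  by case: r1; case: r2; rewrite /= !E /=; ring.
move=> [sw] [sc] [sd]; rewrite rows2_sum_cons.
rewrite (yang_baxter _ _ _ _ _ (v := rows2_sum n z z' ws c d)); last first.
  by move=> s1 s2; apply: IHn.
by case: r1; case: r2; rewrite /= !rows2_sum_cons.
Qed.

(** Both rows start with the horizontal edge 0, and on the state 00 the R-matrix is the scalar
    [wd z z']. Regularity allows this scalar to be cancelled. *)
Lemma rows_sum_swap n z z' zs ws c :
  GRing.lreg (wd z z') -> size ws = n -> size c = n ->
  rows_sum n (z :: z' :: zs) ws c = rows_sum n (z' :: z :: zs) ws c.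
Proof.
move=> reg sw sc; have E u u' : rows_sum n (u :: u' :: zs) ws c =
    \sum_(d : n.-tuple bool) rows2_sum n u u' ws c d false false * rows_sum n zs ws d.
  rewrite /=; under eq_bigr => d _ do rewrite mulr_sumr.
  rewrite exchange_big; apply: eq_bigr => d _ /=.
  by rewrite mulr_suml; apply: eq_bigr => e _; rewrite mulrA.
rewrite !E; apply: eq_bigr => d _; congr (_ * _); apply: reg.
by rewrite [RHS]rows2_exchange ?size_tuple.
Qed.

Lemma rows_sum_to_front n z zs zs' ws c :
  {in zs, forall u, GRing.lreg (wd u z)} -> size ws = n -> size c = n ->
  rows_sum n (zs ++ z :: zs') ws c = rows_sum n (z :: zs ++ zs') ws c.
Proof.
move=> + sw; elim: zs c => [|u zs IHs] c reg sc //.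
rewrite [RHS](_ : _ = rows_sum n (u :: z :: zs ++ zs') ws c); last first.
  by apply/esym/rows_sum_swap => //; apply: reg; rewrite mem_head.
rewrite cat_cons /=; apply: eq_bigr => d _; rewrite IHs ?size_tuple //.
by move=> v vzs; apply: reg; rewrite inE vzs orbT.
Qed.

(** * Edge configurations of nonzero weight are ASMs *)

Fixpoint rows_prod n zs ws (c : seq bool) (X : seq (n.-tuple bool)) : R :=
  match zs, X with
  | [::], [::] => (all id c)%:R
  | z :: zs', d :: X' => row_sum z ws c d false * rows_prod zs' ws d X'
  | _, _ => 0
  end.

Lemma rows_sumE n m zs ws c : size zs = m ->
  rows_sum n zs ws c = \sum_(X : m.-tuple (n.-tuple bool)) rows_prod zs ws c X.
Proof.
elim: zs m c => [|z zs IHs] [|m] c //= => [_|[sz]].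
  by rewrite (big_pred1 [tuple]) // => t; apply/esym/eqP/tuple0.
rewrite (sum_tuple_cons _ (fun X => rows_prod (z :: zs) ws c X)).
by apply: eq_bigr => d _ /=; rewrite (IHs m) // mulr_sumr.
Qed.

Lemma codom_recl n (T : Type) (F : 'I_n.+1 -> T) :
  codom F = F ord0 :: codom (fun i => F (lift ord0 i)).
Proof. by rewrite /codom /image_mem enum_ordSl /= -map_comp. Qed.

Lemma rows_prodE n m (z : 'I_m -> R) ws (C : nat -> n.-tuple bool) :
  rows_prod (codom z) ws (C 0%N) (codom (fun i : 'I_m => C i.+1)) =
  (\prod_(i < m) row_sum (z i) ws (C i) (C i.+1) false) * (all id (C m))%:R.
Proof.
elim: m z C => [|m IHm] z C.
  by rewrite big_ord0 mul1r /codom /image_mem enum_ord0.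
rewrite !codom_recl /= big_ord_recl -mulrA; congr (_ * _).
exact: (IHm _ (fun k => C k.+1)).
Qed.

Definition increment (c d : bool) : int := d%:R - c%:R.

(** [vertex] vanishes in the two cases where the integer [r + d - c] is -1 or 2. Elsewhere this
    integer agrees with the exclusive or, so horizontal edges are prefix sums of increments. *)
Lemma row_sum_neq0 n z (w : 'I_n -> R) (c d : 'I_n -> bool) (r : bool) :
  row_sum z (codom w) (codom c) (codom d) r != 0 ->
  (forall k, r%:R + \sum_(j < n | (j < k)%N) increment (c j) (d j) \in [:: 0; 1]) /\
  r%:R + \sum_(j < n) increment (c j) (d j) = 1.
Proof.
elim: n w c d r => [|n IHn] w c d r.
  rewrite /codom /image_mem enum_ord0 /= big_ord0.
  by case: r; rewrite ?eqxx // => _; split=> // k; rewrite big_ord0.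
rewrite !codom_recl /= => nz.
have Er : (r (+) c ord0 (+) d ord0)%:R = r%:R + increment (c ord0) (d ord0).
  by move: nz; case: r; case: (c _); case: (d _); rewrite /= ?mul0r ?eqxx.
have [|pre tot] := IHn (fun j => w (lift ord0 j)) (fun j => c (lift ord0 j))
    (fun j => d (lift ord0 j)) (r (+) c ord0 (+) d ord0).
  by apply: contraNneq nz => ->; rewrite mulr0.
split; last by rewrite big_ord_recl addrA -Er.
case=> [|k]; first by rewrite big1 // addr0; case: (r).
by rewrite sum_ord_ltS addrA -Er.
Qed.

Lemma row_sum_val n z (w : 'I_n -> R) (c d : 'I_n -> bool) (r : bool) :
  (forall k, r%:R + \sum_(j < n | (j < k)%N) increment (c j) (d j) \in [:: 0; 1]) ->
  r%:R + \sum_(j < n) increment (c j) (d j) = 1 ->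
  row_sum z (codom w) (codom c) (codom d) r =
  \prod_j entry_weight (wA z (w j)) (x * wA z (w j)) (wB z (w j)) (wB z (w j))
     (y * wf z * wf (w j)) (r%:R + \sum_(k < n | (k < j)%N) increment (c k) (d k))
     (c j)%:R (increment (c j) (d j)).
Proof.
elim: n w c d r => [|n IHn] w c d r pre tot.
  move: tot; rewrite /codom /image_mem enum_ord0 /= !big_ord0.
  by case: r {pre}.
rewrite !codom_recl /= big_ord_recl big1 // addr0.
have := pre 1%N; rewrite sum_ord_ltS big1 // addr0 => pre1.
have Er : (r (+) c ord0 (+) d ord0)%:R = r%:R + increment (c ord0) (d ord0).
  by move: pre1; case: r {pre tot}; case: (c _); case: (d _).
congr (_ * _).
  by move: pre1; case: r {pre tot Er}; case: (c _); case: (d _).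
rewrite IHn; last 2 first.
- by move=> k; rewrite Er; have := pre k.+1; rewrite sum_ord_ltS addrA.
- by rewrite Er; move: tot; rewrite big_ord_recl addrA.
by apply: eq_bigr => j _; rewrite lift0 sum_ord_ltS Er -[in LHS]addrA.
Qed.

(* The vertical edges above row [k]. *)
Definition asm_rows n (A : 'M[int]_n) (k : nat) : n.-tuple bool :=
  [tuple col_prefix A k j == 1 | j < n].

Lemma codom_tuple n (T : Type) (t : n.-tuple T) : codom (tnth t) = t.
Proof. exact: map_tnth_enum. Qed.

Lemma sum_prefix_asm_rows n (A : asm n) (i : 'I_n) k :
  (0 : int) + \sum_(j < n | (j < k)%N)
     increment (tnth (asm_rows A i) j) (tnth (asm_rows A i.+1) j)
  = row_prefix A i k.
Proof.
rewrite add0r; apply: eq_bigr => j _; rewrite !tnth_mktuple /increment.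
have := asm_col_prefix A i.+1 j; have := asm_col_prefix A i j.
rewrite col_prefixS !inE; move: (col_prefix A i j) (A i j) => p e.
by case/orP => /eqP->; case/orP => /eqP E; lia.
Qed.

Lemma col_prefix_asm_rows n (A : asm n) k (j : 'I_n) :
  (tnth (asm_rows A k) j)%:R = col_prefix A k j.
Proof.
by rewrite tnth_mktuple; have := asm_col_prefix A k j; rewrite !inE => /orP[]/eqP->.
Qed.

Definition asm_code n (A : asm n) : n.-tuple (n.-tuple bool) :=
  [tuple asm_rows A i.+1 | i < n].

Lemma asm_code_inj n : injective (@asm_code n).
Proof.
move=> A B E; have EC k j : (k <= n)%N -> col_prefix A k j = col_prefix B k j.
  case: k => [|k] kn; first by rewrite !col_prefix0.
  have := congr1 (fun X => tnth X (Ordinal kn)) E.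
  by rewrite !tnth_mktuple -!col_prefix_asm_rows => ->.
apply/asm_inj/matrixP => i j; have := EC i.+1 j (ltn_ord i).
by rewrite !col_prefixS EC 1?ltnW // => /addrI.
Qed.

Lemma asm_rows0 n (A : 'M[int]_n) : asm_rows A 0 = nseq n false :> seq bool.
Proof.
apply: (@eq_from_nth _ false); first by rewrite size_tuple size_nseq.
move=> j; rewrite size_tuple => jn; rewrite nth_nseq jn.
by rewrite -[j]/(val (Ordinal jn)) -tnth_nth tnth_mktuple col_prefix0.
Qed.

Lemma asm_weight_rows n (z w : 'I_n -> R) (A : asm n) :
  asm_weight (fun i j => wA (z i) (w j)) (fun i j => x * wA (z i) (w j))
    (fun i j => wB (z i) (w j)) (fun i j => wB (z i) (w j))
    (fun i j => y * wf (z i) * wf (w j)) A =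
  rows_prod (codom z) (codom w) (nseq n false) (asm_code A).
Proof.
have -> : asm_code A = codom (fun i : 'I_n => asm_rows A i.+1) :> seq _ by [].
rewrite -(asm_rows0 A) rows_prodE.
have -> : all id (asm_rows A n).
  apply/allP => b /codomP[j ->]; rewrite col_prefix_full //.
  by rewrite asm_col_sum.
rewrite mulr1; apply: eq_bigr => i _.
rewrite -(codom_tuple (asm_rows A i)) -(codom_tuple (asm_rows A i.+1)).
rewrite row_sum_val => [|k|]; last 2 first.
- by rewrite sum_prefix_asm_rows; apply: asm_row_prefix.
- have := sum_prefix_asm_rows A i n; rewrite row_prefix_full // asm_row_sum.
  by under eq_bigl => j do rewrite ltn_ord.
apply: eq_bigr => j _; rewrite sum_prefix_asm_rows col_prefix_asm_rows.
congr entry_weight; apply: (addrI (row_prefix A i j)).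
rewrite -row_prefixS -!sum_prefix_asm_rows -addrA; congr (_ + _).
rewrite (bigD1 j) //= addrC; congr (_ + _).
by apply: eq_bigl => k; rewrite ltnS [RHS]ltn_neqAle andbC.
Qed.

(** The increments of the vertical edges form the ASM: the edges themselves are its column prefixes,
    a nonzero row factor controls its row prefixes and row sums, and the bottom boundary makes its
    column sums 1. *)
Lemma rows_prod_neq0 n (z w : 'I_n -> R) (X : n.-tuple (n.-tuple bool)) :
  rows_prod (codom z) (codom w) (nseq n false) X != 0 ->
  exists A, X = asm_code A.
Proof.
pose C k := nth [tuple of nseq n false] ([tuple of nseq n false] :: X) k.
have EX : X = codom (fun i : 'I_n => C i.+1) :> seq _.
  rewrite -[LHS]codom_tuple; apply: eq_codom => i.
  by rewrite (tnth_nth [tuple of nseq n false]).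
rewrite EX -[nseq n false]/(tval (C 0%N)) rows_prodE => nz.
have Cn j : tnth (C n) j.
  have : all id (C n) by apply: contraNT nz => /negPf->; rewrite mulr0.
  by move/allP; apply; apply: mem_tnth.
have row_nz (i : 'I_n) : row_sum (z i) (codom w) (codom (tnth (C i)))
    (codom (tnth (C i.+1))) false != 0.
  by apply: contraNneq nz; rewrite !codom_tuple (bigD1 i) //= => ->; rewrite !mul0r.
pose A : 'M[int]_n := \matrix_(i, j) increment (tnth (C i) j) (tnth (C i.+1) j).
have cpA k j : (k <= n)%N -> col_prefix A k j = (tnth (C k) j)%:R.
  elim: k => [|k IHk] kn.
    by rewrite col_prefix0 (tnth_nth false) /= nth_nseq if_same.
  by rewrite -[k]/(val (Ordinal kn)) col_prefixS mxE IHk 1?ltnW // addrC subrK.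
have rpA i k : row_prefix A i k = (false%:R : int) + \sum_(j < n | (j < k)%N)
    increment (tnth (C i) j) (tnth (C i.+1) j).
  by rewrite add0r; apply: eq_bigr => j _; rewrite mxE.
have Aasm : is_asm A.
  have bin (b : bool) : (b%:R : int) \in [:: 0; 1] by case: b.
  apply/asmP; split=> [i k|i|k j|j].
  - by rewrite rpA; case: (row_sum_neq0 (row_nz i)) => + _; apply.
  - under eq_bigr => j _ do rewrite mxE.
    by case: (row_sum_neq0 (row_nz i)) => _; rewrite add0r.
  - have [kn|/ltnW nk] := leqP k n; first by rewrite cpA.
    by rewrite col_prefix_full // -(col_prefix_full _ _ (leqnn n)) cpA.
  by rewrite -(col_prefix_full _ _ (leqnn n)) cpA // Cn.
exists (ASM Aasm); apply: eq_from_tnth => i; rewrite tnth_mktuple.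
apply: eq_from_tnth => j; rewrite tnth_mktuple /= cpA //.
rewrite /C /= -tnth_nth; by case: (tnth _ j).
Qed.

Lemma spectral_sum_rows n (z w : 'I_n -> R) :
  spectral_sum z w = rows_sum n (codom z) (codom w) (nseq n false).
Proof.
rewrite (@rows_sumE _ n) ?size_codom ?card_ord //.
rewrite (bigID (fun X => X \in @asm_code n @: setT)) /= [X in _ + X]big1 ?addr0.
  rewrite big_imset; last by apply: in2W; apply: asm_code_inj.
  apply: eq_big => [A|A _]; [by rewrite inE | exact: asm_weight_rows].
move=> X; apply: contraNeq => /rows_prod_neq0[A ->]; exact: imset_f.
Qed.

Definition consf n (T : Type) (a : T) (g : 'I_n -> T) (i : 'I_n.+1) : T :=
  if unlift ord0 i is Some j then g j else a.

Lemma consf0 n (T : Type) (a : T) (g : 'I_n -> T) : consf a g ord0 = a.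
Proof. by rewrite /consf unlift_none. Qed.

Lemma consf_lift n (T : Type) (a : T) (g : 'I_n -> T) i :
  consf a g (lift ord0 i) = g i.
Proof. by rewrite /consf liftK. Qed.

Lemma spectral_sum_to_front n (z w : 'I_n.+1 -> R) i :
  (forall k, GRing.lreg (wd (z k) (z i))) ->
  spectral_sum z w = spectral_sum (consf (z i) (fun k => z (lift i k))) w.
Proof.
move=> reg; rewrite !spectral_sum_rows; set ws := codom w; set c := nseq _ _.
have -> : codom (consf (z i) (fun k => z (lift i k))) =
    z i :: codom (fun k => z (lift i k)).
  rewrite codom_recl consf0; congr (_ :: _).
  by apply: eq_codom => k; rewrite consf_lift.
have sz m (g : 'I_m -> R) : size (codom g) = m by rewrite size_codom card_ord.
have nth_codom m (g : 'I_m -> R) (k : 'I_m) : nth 0 (codom g) k = g k.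
  by rewrite (nth_map k) ?size_enum_ord // nth_ord_enum.
have take_lift : take i (codom z) = take i (codom (fun k => z (lift i k))).
  apply: (@eq_from_nth _ 0); rewrite !size_take !sz.
    by have := ltn_ord i; rewrite ltnS; case: ltngtP.
  rewrite ltn_ord => k ki; rewrite !nth_take //.
  have kn : (k < n)%N by rewrite (leq_trans ki) // -ltnS.
  rewrite -[k in RHS]/(val (Ordinal kn)) [RHS]nth_codom.
  rewrite -[k in LHS]/(val (widen_ord (leqnSn n) (Ordinal kn))) nth_codom.
  by congr z; apply: val_inj; rewrite /= /bump leqNgt ki.
have drop_lift : drop i.+1 (codom z) = drop i (codom (fun k => z (lift i k))).
  apply: (@eq_from_nth _ 0); rewrite !size_drop !sz ?subSS // => k ki.
  rewrite !nth_drop; have kn : (i + k < n)%N by lia.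
  rewrite -[(i + k)%N]/(val (Ordinal kn)) [RHS]nth_codom.
  have -> : (i.+1 + k)%N = lift i (Ordinal kn) by rewrite /= /bump leq_addr.
  by rewrite nth_codom.
rewrite -(cat_take_drop i (codom (fun k => z (lift i k)))) -take_lift -drop_lift.
rewrite -[in LHS](cat_take_drop i (codom z)) (drop_nth 0) ?sz // nth_codom.
apply: rows_sum_to_front; rewrite ?sz ?size_nseq // => u /mem_take /codomP[k ->].
exact: reg.
Qed.

End SixVertex.

Lemma asm_sum0 (R : comNzRingType) (a1 a2 b1 b2 c : 'I_0 -> 'I_0 -> R) :
  asm_sum a1 a2 b1 b2 c = 1.
Proof.
have asm0 : is_asm (0 : 'M[int]_0).
  by apply/and3P; split; apply/forallP => -[].
rewrite /asm_sum (big_pred1 (ASM asm0)) => [|A]; last first.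
  by apply/esym/eqP/val_inj/matrixP => -[].
by rewrite /asm_weight big_ord0.
Qed.

(** * Vandermonde products *)

Fixpoint vdm (R : comNzRingType) n : ('I_n -> R) -> R :=
  if n is m.+1 return ('I_n -> R) -> R then
    fun z => (\prod_(j < m) (z (lift ord0 j) - z ord0)) *
             vdm (fun j => z (lift ord0 j))
  else fun=> 1.

Lemma eq_vdm (R : comNzRingType) n (z z' : 'I_n -> R) : z =1 z' -> vdm z = vdm z'.
Proof.
elim: n z z' => [|n IHn] z z' E //=.
rewrite (IHn _ (fun j => z' (lift ord0 j))) => [|j]; last exact: E.
by congr (_ * _); apply: eq_bigr => j _; rewrite !E.
Qed.

Lemma lift_lift0 n (i : 'I_n.+1) (k : 'I_n) :
  lift (lift ord0 i) (lift ord0 k) = lift ord0 (lift i k).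
Proof. by apply: val_inj; rewrite /= /bump /= !add1n ltnS addnS. Qed.

Lemma vdm_recl (R : comNzRingType) n (z : 'I_n.+1 -> R) :
  vdm z = (\prod_j (z (lift ord0 j) - z ord0)) * vdm (fun j => z (lift ord0 j)).
Proof. by []. Qed.

(** The sign is that of the cofactor of row [i] in the first column, with which it is matched in the
    interpolation. *)
Lemma vdm_to_front (R : comNzRingType) n (z : 'I_n.+1 -> R) (i : 'I_n.+1) :
  vdm z = (-1) ^+ i * (\prod_k (z (lift i k) - z i)) * vdm (fun k => z (lift i k)).
Proof.
elim: n z i => [|n IHn] z i.
  by rewrite (ord1 i) /= !big_ord0 !mul1r.
case: (unliftP ord0 i) => [i'|] ->; last by rewrite expr0 mul1r.
rewrite lift0 exprS [LHS]vdm_recl (IHn (fun j => z (lift ord0 j)) i').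
rewrite [in RHS]vdm_recl (bigD1_ord i') // [X in _ = _ * X * _]big_ord_recl.
have Ezero : lift (lift ord0 i') ord0 = ord0 by apply: val_inj.
rewrite Ezero.
have Eprod a : \prod_k (z (lift (lift ord0 i') (lift ord0 k)) - a) =
    \prod_k (z (lift ord0 (lift i' k)) - a).
  by apply: eq_bigr => k _; rewrite lift_lift0.
rewrite !Eprod.
have -> : vdm (fun k => z (lift (lift ord0 i') (lift ord0 k))) =
    vdm (fun k => z (lift ord0 (lift i' k))).
  by apply: eq_vdm => k; rewrite lift_lift0.
set V := vdm _; set P1 := \big[_/_]_(_ < _) (_ - z ord0).
by rewrite -/P1 /=; ring.
Qed.

Lemma spectral_sum_corner0 (R : comNzRingType) (x y : R) n (z w : 'I_n.+1 -> R) :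
  wA y (z ord0) (w ord0) = 0 ->
  spectral_sum x y z w =
  (\prod_j wB x y (z ord0) (w (lift ord0 j))) *
  (\prod_i wB x y (z (lift ord0 i)) (w ord0)) *
  spectral_sum x y (fun i => z (lift ord0 i)) (fun j => w (lift ord0 j)).
Proof. by move=> A0; rewrite /spectral_sum asm_sum_corner0. Qed.

Definition wAB (R : comNzRingType) (x y z w : R) := wA y z w * wB x y z w.

(** * The Izergin-Korepin determinant *)

Section IzerginKorepin.
Variables (F : fieldType) (x y : F).
Local Notation A := (wA y).
Local Notation B := (wB x y).
Local Notation ab := (wAB x y).
Local Notation W := (spectral_sum x y).

Definition ik_mx n (z w : 'I_n -> F) : 'M[F]_n := \matrix_(i, j) (ab (z i) (w j))^-1.

Definition wg (z : F) := y * z - z + 1.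

(** Nonvanishing [wg] gives A(z_i, w) a root in w, [y != 0] and injectivity make these roots
    distinct and the Vandermonde products invertible, [wAB] is inverted in the matrix, and [wd] is
    cancelled when rows are exchanged. *)
Definition generic n (z w : 'I_n -> F) :=
  [/\ [/\ y != 0, injective z & injective w], forall i, wg (z i) != 0,
      forall i j, ab (z i) (w j) != 0 & forall i j, wd x y (z i) (z j) != 0].

Lemma generic_sub n m (z w : 'I_n -> F) (f g : 'I_m -> 'I_n) :
  injective f -> injective g -> generic z w ->
  generic (fun i => z (f i)) (fun i => w (g i)).
Proof.
move=> inj_f inj_g [[y0 iz iw] hg hab hd]; split=> //; split=> //.
  by move=> i j /iz /inj_f.
by move=> i j /iw /inj_g.
Qed.

Definition polA (z : F) : {poly F} := wg z *: 'X + (z - 1)%:P.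
Definition polB (z : F) : {poly F} := - (x * (z - 1)) *: 'X + (y + x * (z - 1))%:P.

Lemma polAE z t : (polA z).[t] = A z t.
Proof. by rewrite hornerD hornerZ hornerX hornerC /wA /wg; ring. Qed.

Lemma polBE z t : (polB z).[t] = B z t.
Proof. by rewrite hornerD hornerZ hornerX hornerC /wB; ring. Qed.

Lemma size_affine (a b : F) : (size (a *: 'X + b%:P)%R <= 2)%N.
Proof.
rewrite (leq_trans (size_polyD _ _)) // geq_max.
rewrite (leq_trans (size_scale_leq _ _)) ?size_polyX //.
by rewrite (leq_trans (size_polyC_leq1 _)).
Qed.

(** The first column of an ASM holds a single 1 and no -1. Each of its [n] zeros contributes an
    affine factor in [t] and the 1 contributes a constant, so the degree is at most [n]. *)
Lemma spectral_sum_poly n (z : 'I_n.+1 -> F) (w : 'I_n -> F) :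
  exists2 p : {poly F}, (size p <= n.+1)%N & forall t, p.[t] = W z (consf t w).
Proof.
pose pA (M : asm n.+1) i := if M i ord0 == 1 then 1 else
  if col_prefix M i ord0 == 0 then polA (z i) else polB (z i).
pose rest (M : asm n.+1) := \prod_i \prod_j
   entry_weight (A (z i) (w j)) (x * A (z i) (w j)) (B (z i) (w j)) (B (z i) (w j))
     (y * wf x y (z i) * wf x y (w j)) (row_prefix M i (lift ord0 j))
     (col_prefix M i (lift ord0 j)) (M i (lift ord0 j)).
exists (\sum_(M : asm n.+1) rest M *: \prod_i pA M i) => [|t]; last first.
  rewrite horner_sum; apply: eq_bigr => M _; rewrite hornerZ horner_prod mulrC -big_split.
  apply: eq_bigr => i _; rewrite big_ord_recl consf0 row_prefix0; congr (_ * _); last first.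
    by apply: eq_bigr => j _; rewrite consf_lift.
  have M0 : 0 <= M i ord0 by have := asm_row0_ge0 (asm_tr M) i; rewrite mxE.
  rewrite /entry_weight /pA eqxx; case: ifP => [_|Mi]; first by rewrite hornerC.
  have -> : M i ord0 == 0.
    by have := asm_entry M i ord0; move: Mi M0; rewrite !inE; lia.
  by case: ifP => _; rewrite ?polAE ?polBE.
apply: (leq_trans (size_sum _ _ _)); apply/bigmax_leqP => M _.
apply: (leq_trans (size_scale_leq _ _)); apply: (leq_trans (size_poly_prod_leq _ _)).
have M0 i : 0 <= M i ord0 by have := asm_row0_ge0 (asm_tr M) i; rewrite mxE.
have sum1 : (\sum_i `|M i ord0| = 1)%N.
  apply/eqP; rewrite -eqz_nat (big_morph _ PoszD (erefl _)).
  by rewrite (eq_bigr (fun i => M i ord0)) ?asm_col_sum // => i _; rewrite gez0_abs.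
have : (\sum_i (size (pA M i) + `|M i ord0|) <= \sum_(i < n.+1) 2)%N.
  apply: leq_sum => i _; rewrite /pA; case: ifP => [/eqP->|Mi]; first by rewrite size_poly1.
  have -> : M i ord0 = 0.
    by have := asm_entry M i ord0; move: Mi (M0 i); rewrite !inE; lia.
  by rewrite addn0; case: ifP => _; apply: size_affine.
rewrite big_split /= sum1 sum_nat_const !card_ord; lia.
Qed.

Lemma izergin_korepin n (z w : 'I_n -> F) : generic z w ->
  y ^+ 'C(n, 2) * vdm z * vdm w * W z w =
  (\prod_i \prod_j ab (z i) (w j)) * \det (ik_mx z w).
Proof.
elim: n z w => [|n IHn] z w gen.
  by rewrite det_mx00 big_ord0 /W asm_sum0 bin0n expr0 !mulr1.
have [[y0 iz iw] hg hab hd] := gen.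
pose w' j := w (lift ord0 j).
have Ew : w =1 consf (w ord0) w'.
  by move=> j; case: (unliftP ord0 j) => [k|] ->; rewrite ?consf0 ?consf_lift.
have [p sp pE] := spectral_sum_poly z w'.
pose sg i := (1 - z i) / wg (z i).
have sgE i k : A (z k) (sg i) = y * (z k - z i) / wg (z i).
  by move: (hg i); rewrite /wA /sg /wg => h; field.
have A0E i j : A (z i) (w' j) = wg (z i) * (w' j - sg i).
  by move: (hg i); rewrite /wA /sg /wg => h; field.
have genl i : generic (fun k => z (lift i k)) w'.
  by apply: (generic_sub (f := lift i) (g := lift ord0)) gen; apply: lift_inj.
(* Both sides are polynomials of degree at most 2n in [w ord0]; they agree at the
   n + 1 roots [sg i] of [A (z i)] and vanish at the n other columns. *)
pose K := y ^+ 'C(n.+1, 2) * vdm z * vdm w'.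
pose L := K *: (p * \prod_j ((w' j)%:P - 'X)).
pose M' i := ik_mx (fun k => z (lift i k)) w'.
pose P' := \prod_i \prod_j ab (z i) (w' j).
(* This is the right-hand side expanded along the first column with the denominators of this column
   cleared, so it has a value also at the nodes where the matrix has none. *)
pose N := \sum_(i < n.+1) (P' * (-1) ^+ i * \det (M' i)) *:
   \prod_(k < n) (polA (z (lift i k)) * polB (z (lift i k))).
have NE t : N.[t] = \sum_(i < n.+1) P' * (-1) ^+ i * \det (M' i) *
    \prod_(k < n) ab (z (lift i k)) t.
  rewrite horner_sum; apply: eq_bigr => i _; rewrite hornerZ horner_prod.
  by congr (_ * _); apply: eq_bigr => k _; rewrite hornerM polAE polBE.
have Ndet t : (forall k, ab (z k) t != 0) ->
    N.[t] = P' * (\prod_k ab (z k) t) * \det (ik_mx z (consf t w')).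
  move=> nz; rewrite NE (expand_det_col _ ord0) mulr_sumr; apply: eq_bigr => i _.
  rewrite (bigD1_ord i) //= mxE consf0 /cofactor addn0.
  have -> : row' i (col' ord0 (ik_mx z (consf t w'))) = M' i.
    by apply/matrixP => k j; rewrite !mxE consf_lift.
  by field.
suff LN : L = N.
  have := congr1 (fun q => q.[w ord0]) LN; rewrite Ndet => [|k]; last exact: hab.
  rewrite /L hornerZ hornerM horner_prod pE -(eq_spectral_sum _ _ (frefl _) Ew).
  have -> : ik_mx z (consf (w ord0) w') = ik_mx z w.
    by apply/matrixP => i j; rewrite !mxE -Ew.
  have -> : P' * \prod_k ab (z k) (w ord0) = \prod_i \prod_j ab (z i) (w j).
    by rewrite -big_split; apply: eq_bigr => i _ /=; rewrite big_ord_recl mulrC.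
  move=> <-; rewrite /K /=.
  have -> : \prod_j ((w' j)%:P - 'X).[w ord0] = \prod_j (w' j - w ord0).
    by apply: eq_bigr => j _; rewrite hornerD hornerN hornerC hornerX.
  by ring.
apply/eqP; rewrite -subr_eq0; apply/eqP.
apply: (@roots_geq_poly_eq0 _ _ (codom sg ++ codom w')).
- rewrite all_cat; apply/andP; split; apply/allP => t /codomP[i ->].
    rewrite /root hornerD hornerN subr_eq0 NE /L hornerZ hornerM horner_prod pE.
    rewrite (bigD1 i) //= [X in _ == _ + X]big1 ?addr0 => [|k ki]; last first.
      case: (unliftP k i) ki => [k' Ek _|->]; last by rewrite eqxx.
      by rewrite (bigD1 k') //= -Ek /wAB sgE subrr !(mulr0, mul0r).
    (* On the right only the term [i] survives at [sg i]. On the left, symmetry brings row [i] to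
       the top, where the corner weight vanishes at [sg i], and the sum factors down to size [n]. *)
    rewrite (spectral_sum_to_front _ _ (i := i)) => [|k]; last first.
      exact/mulfI/hd.
    rewrite spectral_sum_corner0 !consf0 ?sgE ?subrr ?mulr0 ?mul0r //.
    rewrite (eq_spectral_sum _ _ (z' := fun k => z (lift i k)) (w' := w'));
      [|by move=> k; rewrite consf_lift..].
    rewrite (eq_bigr (fun j => B (z i) (w' j))) => [|j _]; last by rewrite consf_lift.
    rewrite [X in _ * (_ * X * _ * _)](eq_bigr (fun k => B (z (lift i k)) (sg i)))
      => [|j _]; last by rewrite consf_lift.
    rewrite [X in _ * (_ * X) == _](eq_bigr (fun j => w' j - sg i)) => [|j _]; last first.
      by rewrite hornerD hornerN hornerC hornerX.
    have := IHn _ _ (genl i); set W' := spectral_sum _ _ _ _ => IH.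
    rewrite -/(M' i) in IH.
    have EP : P' = (\prod_j A (z i) (w' j)) * (\prod_j B (z i) (w' j)) *
        \prod_k \prod_j ab (z (lift i k)) (w' j).
      by rewrite /P' (bigD1_ord i) //; congr (_ * _); rewrite -big_split.
    have Eab : \prod_(k < n) ab (z (lift i k)) (sg i) =
        (\prod_k A (z (lift i k)) (sg i)) * \prod_k B (z (lift i k)) (sg i).
      by rewrite -big_split.
    (* The factors [wg (z i)] cancel pairwise and differences of parameters remain, which rebuild
       the Vandermonde products. The power [y ^+ n] raises the exponent from C(n,2) to C(n+1,2). *)
    have EA : (\prod_j A (z i) (w' j)) * (\prod_k A (z (lift i k)) (sg i)) =
        y ^+ n * (\prod_k (z (lift i k) - z i)) * \prod_j (w' j - sg i).
      rewrite -!big_split -[X in _ ^+ X]card_ord -prodr_const -!big_split.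
      apply: eq_bigr => k _ /=; rewrite A0E sgE.
      by move: (hg i) => h; field.
    rewrite EP Eab /K (vdm_to_front z i) binS bin1 exprD; apply/eqP.
    set PB := \prod_j B _ _; set PBk := \prod_k B _ _; set PP := \prod_k \prod_j _.
    transitivity ((PP * \det (M' i)) * ((-1) ^+ i * PB * PBk) *
      ((\prod_j A (z i) (w' j)) * (\prod_k A (z (lift i k)) (sg i)))); last by ring.
    by rewrite -IH EA; ring.
  rewrite /root hornerD hornerN Ndet => [|k]; last exact: hab.
  rewrite (_ : \det _ = 0) ?mulr0 ?subr0.
    by rewrite /L hornerZ hornerM horner_prod (bigD1 i) //= hornerD hornerN hornerC hornerX
      subrr !(mul0r, mulr0).
  rewrite -det_tr; apply: (@determinant_alternate _ _ _ ord0 (lift ord0 i)) => // j.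
  by rewrite !mxE consf0 consf_lift.
- rewrite cat_uniq; apply/and3P; split.
  + rewrite map_inj_uniq ?enum_uniq // => i j E.
    have := sgE i j; rewrite E sgE subrr mulr0 mul0r => /esym/eqP.
    by rewrite !mulf_eq0 invr_eq0 (negPf y0) (negPf (hg _)) orbF /= subr_eq0 => /eqP/iz.
  + apply/hasPn => t /codomP[j ->]; apply/negP => /codomP[i E].
    by have := hab i (lift ord0 j); rewrite /wAB A0E E subrr mulr0 mul0r eqxx.
  + by rewrite map_inj_uniq ?enum_uniq // => i j /iw /lift_inj.
have sprod : (size (\prod_j ((w' j)%:P - 'X))%R <= n.+1)%N.
  apply: (leq_trans (size_poly_prod_leq _ _)); rewrite card_ord.
  have : (\sum_(j < n) size ((w' j)%:P - 'X)%R <= \sum_(j < n) 2)%N.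
    apply: leq_sum => j _.
    have -> : (w' j)%:P - 'X = -1 *: 'X + (w' j)%:P by rewrite scaleN1r addrC.
    exact: size_affine.
  by rewrite sum_nat_const card_ord /=; lia.
rewrite size_cat !size_codom !card_ord (leq_trans (size_polyD _ _)) // size_polyN geq_max.
apply/andP; split.
  apply: (leq_trans (size_scale_leq _ _)); apply: (leq_trans (size_polyMleq _ _)).
  by set s := (size p + _)%N; have : (s <= n.+1 + n.+1)%N := leq_add sp sprod; lia.
apply: (leq_trans (size_sum _ _ _)); apply/bigmax_leqP => i _.
apply: (leq_trans (size_scale_leq _ _)); apply: (leq_trans (size_poly_prod_leq _ _)).
have : (\sum_(k < n) size (polA (z (lift i k)) * polB (z (lift i k)))%R <= \sum_(k < n) 3)%N.
  apply: leq_sum => k _; apply: (leq_trans (size_polyMleq _ _)).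
  have sA : (size (polA (z (lift i k))) <= 2)%N by apply: size_affine.
  have sB : (size (polB (z (lift i k))) <= 2)%N by apply: size_affine.
  by set s := (_ + size _)%N; have : (s <= 2 + 2)%N := leq_add sA sB; lia.
by rewrite sum_nat_const card_ord /=; move: (\sum_(_ < _) _)%N => s; lia.
Qed.

End IzerginKorepin.

(** * The Desnanot-Jacobi identity and condensation *)

Lemma lift_max0 n (k : 'I_n) : lift ord_max (lift ord0 k) = lift ord0 (lift ord_max k).
Proof. by apply: val_inj; rewrite /= /bump; have := ltn_ord k; lia. Qed.

Lemma lift_max_eq0 n (k : 'I_n.+1) : (lift ord_max k == ord0) = (k == ord0).
Proof. by rewrite -!val_eqE /= /bump leqNgt ltn_ord. Qed.

Lemma lift0_eq_max n (k : 'I_n.+1) : (lift ord0 k == ord_max) = (k == ord_max).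
Proof. by rewrite -!val_eqE. Qed.

Lemma desnanot_jacobi_reg (R : comNzRingType) n (M : 'M[R]_n.+2) :
  GRing.lreg (\det M) ->
  \det M * \det (\matrix_(i < n, j < n)
      M (lift ord0 (lift ord_max i)) (lift ord0 (lift ord_max j))) =
  \det (row' ord_max (col' ord_max M)) * \det (row' ord0 (col' ord0 M)) -
  \det (row' ord0 (col' ord_max M)) * \det (row' ord_max (col' ord0 M)).
Proof.
move=> reg; set inner := \matrix_(i, j) _.
(* [M *m X] is [M] with its first and last columns replaced by those of
   [(\det M)%:M], and [X] is the identity with two columns of [\adj M]. *)
pose X : 'M[R]_n.+2 := \matrix_(i, j)
  if (j == ord0) || (j == ord_max) then \adj M i j else (i == j)%:R.
have MX i j : (M *m X) i j =
    if (j == ord0) || (j == ord_max) then \det M * (i == j)%:R else M i j.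
  rewrite mxE; case: ifP => [jb|jb].
    have /matrixP/(_ i j) := mul_mx_adj M; rewrite !mxE mulr_natr => <-.
    by apply: eq_bigr => k _; rewrite [X _ _]mxE jb.
  rewrite (bigD1 j) //= mxE jb eqxx mulr1 big1 ?addr0 // => k kj.
  by rewrite mxE jb (negPf kj) mulr0.
have detMX : \det (M *m X) = \det M * (\det M * \det inner).
  rewrite (expand_det_col _ ord0) (bigD1 ord0) //= big1 => [|i i0]; last first.
    by rewrite MX eqxx (negPf i0) mulr0 mul0r.
  rewrite MX !eqxx mulr1 addr0; congr (_ * _).
  rewrite /cofactor mul1r (expand_det_col _ ord_max) (bigD1 ord_max) //= big1 => [|i im].
    rewrite mxE mxE MX lift0_eq_max !eqxx orbT mulr1 addr0; congr (_ * _).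
    rewrite /cofactor -signr_odd oddD addbb mul1r; congr (\det _).
    by apply/matrixP => i j; rewrite 4!mxE MX [RHS]mxE lift0_eq_max !lift_eqF.
  by rewrite mxE mxE MX lift0_eq_max eqxx orbT (inj_eq lift_inj) (negPf im) mulr0 mul0r.
have row0 j : X ord0 (lift ord0 j) = (j == ord_max)%:R * \adj M ord0 ord_max.
  rewrite mxE lift_eqF lift0_eq_max /=; case: eqP => [->|_].
    by rewrite mul1r; congr (\adj M _ _); apply: val_inj.
  by rewrite mul0r.
have detX : \det X = \adj M ord0 ord0 * \adj M ord_max ord_max -
    \adj M ord0 ord_max * \adj M ord_max ord0.
  rewrite (expand_det_row _ ord0) big_ord_recl (bigD1 ord_max) //= big1; last first.
    by move=> j jm; rewrite row0 (negPf jm) !mul0r.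
  rewrite addr0 row0 eqxx mul1r mxE eqxx; congr (_ * _ + _).
    rewrite /cofactor mul1r (expand_det_row _ ord_max) (bigD1 ord_max) //= big1.
      rewrite mxE mxE [X _ _]mxE lift0_eq_max eqxx orbT addr0.
      rewrite /cofactor -signr_odd oddD addbb mul1r (_ : row' _ _ = 1%:M).
        rewrite det1 mulr1; congr (\adj M _ _); exact: val_inj.
      apply/matrixP => i j; rewrite 4!mxE [X _ _]mxE lift0_eq_max !lift_eqF [RHS]mxE.
      by rewrite !(inj_eq lift_inj).
    move=> j jm; rewrite mxE mxE [X _ _]mxE lift_eqF lift0_eq_max (negPf jm).
    by rewrite (inj_eq lift_inj) eq_sym (negPf jm) mul0r.
  rewrite (_ : lift ord0 ord_max = ord_max); last exact: val_inj.
  rewrite -mulrN; congr (_ * _).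
  rewrite /cofactor (expand_det_row _ ord_max) (bigD1 ord0) //= big1 => [|j j0].
    rewrite mxE mxE [X _ _]mxE.
    rewrite (_ : lift ord_max ord0 = ord0); last exact: val_inj.
    rewrite eqxx /= addr0 (_ : lift ord0 ord_max = ord_max); last exact: val_inj.
    rewrite /cofactor (_ : row' _ (col' ord0 _) = 1%:M).
      rewrite det1 mulr1 /= ?addn0 ?add0n exprS -signr_odd.
      by case: (odd n); rewrite ?expr0 ?expr1; ring.
    apply/matrixP => i j; rewrite 4!mxE [X _ _]mxE [RHS]mxE lift_max_eq0 !lift_eqF.
    by rewrite lift_max0 !(inj_eq lift_inj).
  rewrite mxE mxE [X _ _]mxE lift_max_eq0 (negPf j0) lift_eqF.
  rewrite (_ : lift ord0 ord_max = ord_max); last exact: val_inj.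
  by rewrite eq_liftF mul0r.
apply: reg; rewrite -detMX det_mulmx detX; congr (_ * _).
rewrite !mxE /cofactor /= addn0 add0n !mul1r.
rewrite -signr_odd oddD addbb expr0 mul1r.
by rewrite addn0 exprS -signr_odd; case: (odd n); rewrite ?expr0 ?expr1; ring.
Qed.

Lemma desnanot_jacobi (F : idomainType) n (M : 'M[F]_n.+2) :
  \det M * \det (\matrix_(i < n, j < n)
      M (lift ord0 (lift ord_max i)) (lift ord0 (lift ord_max j))) =
  \det (row' ord_max (col' ord_max M)) * \det (row' ord0 (col' ord0 M)) -
  \det (row' ord0 (col' ord_max M)) * \det (row' ord_max (col' ord0 M)).
Proof.
(* ['X%:M + M] has a monic determinant; specialise at 0. *)
have reg : GRing.lreg (\det (char_poly_mx (- M))).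
  exact/mulfI/monic_neq0/char_poly_monic.
have := congr1 (fun p : {poly F} => p.[0]) (desnanot_jacobi_reg reg).
rewrite hornerD hornerN !hornerM.
have detE m (N : 'M[{poly F}]_m) : (\det N).[0] = \det (map_mx (horner_eval 0) N).
  by rewrite det_map_mx.
have ev i j : (char_poly_mx (- M) i j).[0] = M i j.
  by rewrite !mxE hornerD hornerN hornerMn hornerX hornerC mul0rn sub0r opprK.
have EM : map_mx (horner_eval 0) (char_poly_mx (- M)) = M.
  by apply/matrixP => i j; rewrite mxE -[RHS]ev.
rewrite !detE !(map_row', map_col') EM => <-; congr (_ * \det _).
by apply/matrixP => i j; rewrite !mxE -[LHS]ev !mxE.
Qed.

Lemma asm_sum_rmorph (R S : comNzRingType) (phi : {rmorphism R -> S}) n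
    (a1 a2 b1 b2 c : 'I_n -> 'I_n -> R) :
  phi (asm_sum a1 a2 b1 b2 c) =
  asm_sum (fun i j => phi (a1 i j)) (fun i j => phi (a2 i j))
    (fun i j => phi (b1 i j)) (fun i j => phi (b2 i j)) (fun i j => phi (c i j)).
Proof.
rewrite rmorph_sum; apply: eq_bigr => A _; rewrite rmorph_prod.
apply: eq_bigr => i _; rewrite rmorph_prod; apply: eq_bigr => j _.
by rewrite /entry_weight; do 4?case: ifP => _; rewrite ?rmorph1.
Qed.

Lemma spectral_sum_rmorph (R S : comNzRingType) (phi : {rmorphism R -> S}) x y n
    (z w : 'I_n -> R) :
  phi (spectral_sum x y z w) =
  spectral_sum (phi x) (phi y) (fun i => phi (z i)) (fun j => phi (w j)).
Proof.
rewrite asm_sum_rmorph; apply: eq_asm_sum => i j; rewrite /wA /wB /wf;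
  by rewrite !(rmorphB, rmorphD, rmorphM, rmorph1).
Qed.

Lemma vdm_neq0 (F : idomainType) n (z : 'I_n -> F) : injective z -> vdm z != 0.
Proof.
elim: n z => [|n IHn] z inj; first exact: oner_neq0.
rewrite mulf_neq0 //; last by apply: IHn => i j /inj/lift_inj.
apply/prodf_neq0 => j _; rewrite subr_eq0 (inj_eq inj) eq_sym.
exact: neq_lift.
Qed.

(** Only the pair of extreme indices is missing from the two truncated products; it becomes the
    linear factor of the condensation identity. *)
Lemma vdm_condense (R : comNzRingType) n (z : 'I_n.+2 -> R) :
  vdm z * vdm (fun k : 'I_n => z (lift ord0 (lift ord_max k))) =
  (z ord_max - z ord0) * vdm (fun k => z (lift ord_max k)) *
  vdm (fun k => z (lift ord0 k)).
Proof.
rewrite vdm_recl (vdm_recl (fun k => z (lift ord_max k))) (bigD1_ord ord_max) //=.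
rewrite (_ : lift ord0 ord_max = ord_max); last exact: val_inj.
rewrite (_ : lift ord_max ord0 = ord0); last exact: val_inj.
rewrite (eq_vdm (z := fun j => z (lift ord_max (lift ord0 j)))
  (z' := fun k => z (lift ord0 (lift ord_max k)))) => [|k]; last by rewrite lift_max0.
have -> : \prod_(j < n) (z (lift ord_max (lift ord0 j)) - z ord0) =
   \prod_(i < n) (z (lift ord0 (lift ord_max i)) - z ord0).
  by apply: eq_bigr => k _; rewrite lift_max0.
set P := \big[_/_]_(_ < _) _; set V := vdm _; set V' := vdm _.
by rewrite -/P /=; ring.
Qed.

Section Condensation.
Variables (R : comNzRingType) (n : nat) (g : 'I_n.+2 -> 'I_n.+2 -> R).

Lemma prod_ends (h : 'I_n.+2 -> R) :
  \prod_i h i = h ord0 * h ord_max * \prod_(k < n) h (lift ord0 (lift ord_max k)).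
Proof.
rewrite big_ord_recl (bigD1_ord ord_max) //= (_ : lift ord0 ord_max = ord_max) ?mulrA //.
exact: val_inj.
Qed.

Lemma prod_lift0 (h : 'I_n.+2 -> R) :
  \prod_(i < n.+1) h (lift ord0 i) =
  h ord_max * \prod_(k < n) h (lift ord0 (lift ord_max k)).
Proof.
rewrite (bigD1_ord ord_max) //= (_ : lift ord0 ord_max = ord_max) //.
exact: val_inj.
Qed.

Lemma prod_lift_max (h : 'I_n.+2 -> R) :
  \prod_(i < n.+1) h (lift ord_max i) =
  h ord0 * \prod_(k < n) h (lift ord0 (lift ord_max k)).
Proof.
rewrite big_ord_recl (_ : lift ord_max ord0 = ord0); last exact: val_inj.
by congr (_ * _); apply: eq_bigr => k _; rewrite lift_max0.
Qed.

Let inn (k : 'I_n) : 'I_n.+2 := lift ord0 (lift ord_max k).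

(** The full and the inner square cover each cell as often as the top left and the bottom right
    subsquares together, except for the two corners that these subsquares miss. *)
Lemma prod_condense_diag :
  \prod_i \prod_j g i j * \prod_i \prod_j g (inn i) (inn j) =
  g ord0 ord_max * g ord_max ord0 *
  \prod_i \prod_j g (lift ord_max i) (lift ord_max j) *
  \prod_i \prod_j g (lift ord0 i) (lift ord0 j).
Proof.
rewrite (prod_ends (fun i => \prod_j g i j)).
rewrite (prod_lift0 (fun i => \prod_j g i (lift ord0 j))).
rewrite (prod_lift_max (fun i => \prod_j g i (lift ord_max j))).
rewrite !prod_ends !prod_lift0 !prod_lift_max.
under [X in _ * X * _ = _]eq_bigr => k _ do rewrite prod_ends.
under [X in _ = _ * (_ * X) * _]eq_bigr => k _ do rewrite prod_lift_max.
under [X in _ = _ * _ * (_ * X)]eq_bigr => k _ do rewrite prod_lift0.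
rewrite !big_split /=.
by ring.
Qed.

Lemma prod_condense_antidiag :
  \prod_i \prod_j g i j * \prod_i \prod_j g (inn i) (inn j) =
  g ord0 ord0 * g ord_max ord_max *
  \prod_i \prod_j g (lift ord_max i) (lift ord0 j) *
  \prod_i \prod_j g (lift ord0 i) (lift ord_max j).
Proof.
rewrite (prod_ends (fun i => \prod_j g i j)).
rewrite (prod_lift0 (fun i => \prod_j g i (lift ord_max j))).
rewrite (prod_lift_max (fun i => \prod_j g i (lift ord0 j))).
rewrite !prod_ends !prod_lift0 !prod_lift_max.
under [X in _ * X * _ = _]eq_bigr => k _ do rewrite prod_ends.
under [X in _ = _ * (_ * X) * _]eq_bigr => k _ do rewrite prod_lift0.
under [X in _ = _ * _ * (_ * X)]eq_bigr => k _ do rewrite prod_lift_max.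
rewrite !big_split /=.
by ring.
Qed.
End Condensation.

Definition sub_sum (R : comNzRingType) (x y : R) n (z w : 'I_n.+1 -> R) i j :=
  spectral_sum x y (fun k => z (lift i k)) (fun k => w (lift j k)).

Lemma condensation_generic (F : fieldType) (x y : F) n (z w : 'I_n.+2 -> F) :
  generic x y z w ->
  y * (z ord_max - z ord0) * (w ord_max - w ord0) * spectral_sum x y z w *
    spectral_sum x y (fun k : 'I_n => z (lift ord0 (lift ord_max k)))
                     (fun k : 'I_n => w (lift ord0 (lift ord_max k))) =
  wAB x y (z ord0) (w ord_max) * wAB x y (z ord_max) (w ord0) *
    sub_sum x y z w ord_max ord_max * sub_sum x y z w ord0 ord0 -
  wAB x y (z ord0) (w ord0) * wAB x y (z ord_max) (w ord_max) *
    sub_sum x y z w ord0 ord_max * sub_sum x y z w ord_max ord0.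
Proof.
move=> gen; have [[y0 iz iw] _ _ _] := gen.
have liftI (i : 'I_n.+2) : injective (lift i) by apply: lift_inj.
have innI : injective (fun k : 'I_n => lift ord0 (lift ord_max k) : 'I_n.+2).
  by move=> i j /lift_inj/lift_inj.
have ikl i j := izergin_korepin (generic_sub (liftI i) (liftI j) gen).
have ik := izergin_korepin gen; have ikin := izergin_korepin (generic_sub innI innI gen).
have DJ := desnanot_jacobi (ik_mx x y z w).
have minor i j : row' i (col' j (ik_mx x y z w)) =
    ik_mx x y (fun k => z (lift i k)) (fun k => w (lift j k)).
  by apply/matrixP => k l; rewrite !mxE.
rewrite !minor in DJ; move: DJ.
rewrite (_ : \matrix_(i, j) _ = ik_mx x y (fun k : 'I_n => z (lift ord0 (lift ord_max k)))
    (fun k : 'I_n => w (lift ord0 (lift ord_max k)))); last first.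
  by apply/matrixP => k l; rewrite !mxE.
set D := \det (ik_mx x y z w) => DJ.
have Pd := prod_condense_diag (fun i j => wAB x y (z i) (w j)).
have Pa := prod_condense_antidiag (fun i j => wAB x y (z i) (w j)).
have Vz := vdm_condense z; have Vw := vdm_condense w.
have vn (u : 'I_n.+2 -> F) i : injective u -> vdm (fun k => u (lift i k)) != 0.
  by move=> iu; apply: vdm_neq0 => a b /iu/lift_inj.
pose c := y ^+ 'C(n.+1, 2) ^+ 2 * (vdm (fun k => z (lift ord_max k)) *
  vdm (fun k => z (lift ord0 k))) * (vdm (fun k => w (lift ord_max k)) *
  vdm (fun k => w (lift ord0 k))).
have prod_neq0 (a b d e f : F) : a != 0 -> b != 0 -> d != 0 -> e != 0 -> f != 0 ->
    a ^+ 2 * (b * d) * (e * f) != 0.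
  by move=> a0 b0 d0 e0 f0; rewrite !mulf_neq0 ?expf_neq0.
have c0 : c != 0 by apply: prod_neq0; rewrite ?expf_neq0 ?vn.
apply: (mulfI c0).
(* The second difference of the exponents C(n,2) is 1: this is the factor [y] on the left of the
   condensation identity. *)
have Ey : y ^+ 'C(n.+2, 2) * y ^+ 'C(n, 2) = y * y ^+ 'C(n.+1, 2) ^+ 2.
  by rewrite -exprD -exprM -exprS; congr (_ ^+ _); rewrite !binS !bin1 !bin0; lia.
have alg (Y2 Y0 Y1 dz dw v v_in vl v0 u u_in ul u0 s s_in sll s00 s0l sl0
    d d_in dll d00 d0l dl0 p p_in pll p00 p0l pl0 g0l gl0 g00 gll : F) :
    Y2 * Y0 = y * Y1 ^+ 2 -> v * v_in = dz * vl * v0 -> u * u_in = dw * ul * u0 ->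
    Y2 * v * u * s = p * d -> Y0 * v_in * u_in * s_in = p_in * d_in ->
    Y1 * vl * ul * sll = pll * dll -> Y1 * v0 * u0 * s00 = p00 * d00 ->
    Y1 * v0 * ul * s0l = p0l * d0l -> Y1 * vl * u0 * sl0 = pl0 * dl0 ->
    d * d_in = dll * d00 - d0l * dl0 ->
    p * p_in = g0l * gl0 * pll * p00 -> p * p_in = g00 * gll * pl0 * p0l ->
    Y1 ^+ 2 * (vl * v0) * (ul * u0) * (y * dz * dw * s * s_in) =
    Y1 ^+ 2 * (vl * v0) * (ul * u0) *
      (g0l * gl0 * sll * s00 - g00 * gll * s0l * sl0).
  move=> EY Ev Eu E Ein Ell E00 E0l El0 Ed Ep Ep'.
  transitivity ((Y2 * v * u * s) * (Y0 * v_in * u_in * s_in)).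
    transitivity ((y * Y1 ^+ 2) * (dz * vl * v0) * (dw * ul * u0) * (s * s_in)); first by ring.
    by rewrite -EY -Ev -Eu; ring.
  rewrite E Ein; transitivity ((p * p_in) * (dll * d00) - (p * p_in) * (d0l * dl0)).
    by rewrite mulrACA Ed; ring.
  rewrite {1}Ep Ep'.
  transitivity (g0l * gl0 * ((pll * dll) * (p00 * d00)) -
    g00 * gll * ((p0l * d0l) * (pl0 * dl0))); first by ring.
  by rewrite -Ell -E00 -E0l -El0; ring.
exact: (alg _ _ _ _ _ _ _ _ _ _ _ _ _ _ _ _ _ _ _ _ _ _ _ _ _ _ _ _ _ _ _ _ _ _ _
  Ey Vz Vw ik ikin (ikl _ _) (ikl _ _) (ikl _ _) (ikl _ _) DJ Pd Pa).
Qed.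

Section Rmorphism.
Variables (R S : comNzRingType) (phi : {rmorphism R -> S}) (x y : R).

Lemma wAB_rmorph z w :
  phi (wAB x y z w) = wAB (phi x) (phi y) (phi z) (phi w).
Proof.
by rewrite /wAB /wA /wB !(rmorphB, rmorphD, rmorphM, rmorph1).
Qed.

Lemma wd_rmorph z z' : phi (wd x y z z') = wd (phi x) (phi y) (phi z) (phi z').
Proof. by rewrite /wd !(rmorphB, rmorphD, rmorphM, rmorph1). Qed.

Lemma sub_sum_rmorph n (z w : 'I_n.+1 -> R) i j :
  phi (sub_sum x y z w i j) =
  sub_sum (phi x) (phi y) (fun k => phi (z k)) (fun k => phi (w k)) i j.
Proof. exact: spectral_sum_rmorph. Qed.
End Rmorphism.

(** * From indeterminates over the integers to arbitrary commutative rings *)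

Section Universal.
Variable N : nat.
Local Notation P := {mpoly int[N]}.

Definition point_eval (R : comNzRingType) (v : 'I_N -> R) : {rmorphism P -> R} :=
  mmap intr v.

Lemma point_evalX (R : comNzRingType) (v : 'I_N -> R) i : point_eval v 'X_i = v i.
Proof. by rewrite /point_eval /= mmapX mmap1U. Qed.

Definition to_frac : {rmorphism P -> {fraction P}} := @tofrac P.

Lemma frac_inj : injective to_frac.
Proof. by move=> p q /eqP; rewrite tofrac_eq => /eqP. Qed.

(** One integer point suffices to certify a nonzero polynomial. The point with all coordinates 1
    serves for every nonvanishing condition below, since [wA], [wB], [wg] and [wd] all take the
    value 1 there. *)
Lemma frac_neq0 (v : 'I_N -> int) (p : P) : point_eval v p != 0 -> to_frac p != 0.
Proof. by rewrite tofrac_eq0; apply: contraNneq => ->; rewrite rmorph0. Qed.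

Lemma mpolyX_inj : injective (fun i => 'X_i : P).
Proof.
move=> i j /(congr1 (point_eval (fun k => (k == i)%:R : int))).
by rewrite !point_evalX eqxx; case: eqP.
Qed.

End Universal.

(* Difference of the two sides of the condensation identity: it is natural in the
   ring, so its vanishing at indeterminates over [int] gives it everywhere. *)
Definition condensation_defect (R : comNzRingType) (x y : R) n (z w : 'I_n.+2 -> R) : R :=
  y * (z ord_max - z ord0) * (w ord_max - w ord0) * spectral_sum x y z w *
    spectral_sum x y (fun k : 'I_n => z (lift ord0 (lift ord_max k)))
                     (fun k : 'I_n => w (lift ord0 (lift ord_max k))) - (
  wAB x y (z ord0) (w ord_max) * wAB x y (z ord_max) (w ord0) *
    sub_sum x y z w ord_max ord_max * sub_sum x y z w ord0 ord0 -
  wAB x y (z ord0) (w ord0) * wAB x y (z ord_max) (w ord_max) *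
    sub_sum x y z w ord0 ord_max * sub_sum x y z w ord_max ord0).

Lemma condensation_defect_rmorph (R S : comNzRingType) (phi : {rmorphism R -> S})
    (x y : R) n (z w : 'I_n.+2 -> R) :
  phi (condensation_defect x y z w) =
  condensation_defect (phi x) (phi y) (fun k => phi (z k)) (fun k => phi (w k)).
Proof.
rewrite /condensation_defect -!wAB_rmorph -!sub_sum_rmorph -!spectral_sum_rmorph.
by rewrite -!rmorphB -!rmorphM -!rmorphB.
Qed.

Theorem condensation (R : comNzRingType) (x y : R) n (z w : 'I_n.+2 -> R) :
  y * (z ord_max - z ord0) * (w ord_max - w ord0) * spectral_sum x y z w *
    spectral_sum x y (fun k : 'I_n => z (lift ord0 (lift ord_max k)))
                     (fun k : 'I_n => w (lift ord0 (lift ord_max k))) =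
  wAB x y (z ord0) (w ord_max) * wAB x y (z ord_max) (w ord0) *
    sub_sum x y z w ord_max ord_max * sub_sum x y z w ord0 ord0 -
  wAB x y (z ord0) (w ord0) * wAB x y (z ord_max) (w ord_max) *
    sub_sum x y z w ord0 ord_max * sub_sum x y z w ord_max ord0
.
Proof.
apply/eqP; rewrite -subr_eq0 -/(condensation_defect x y z w).
pose N := (2 + (n.+2 + n.+2))%N.
pose X : {mpoly int[N]} := 'X_(lshift _ ord0).
pose Y : {mpoly int[N]} := 'X_(lshift _ ord_max).
pose Z i : {mpoly int[N]} := 'X_(rshift 2 (lshift n.+2 i)).
pose V i : {mpoly int[N]} := 'X_(rshift 2 (rshift n.+2 i)).
have gen : generic (to_frac N X) (to_frac N Y)
    (fun i => to_frac N (Z i)) (fun i => to_frac N (V i)).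
  pose one : 'I_N -> int := fun=> 1.
  split; [split | |..].
  - by apply: (@frac_neq0 _ one); rewrite point_evalX.
  - by move=> i j /frac_inj /mpolyX_inj /rshift_inj /lshift_inj.
  - by move=> i j /frac_inj /mpolyX_inj /rshift_inj /rshift_inj.
  - move=> i; rewrite /wg -(rmorph1 (to_frac N)) -rmorphM -rmorphB -rmorphD.
    apply: (@frac_neq0 _ one).
    by rewrite rmorphD rmorphB rmorphM rmorph1 !point_evalX.
  - move=> i j; rewrite -wAB_rmorph; apply: (@frac_neq0 _ one).
    by rewrite wAB_rmorph !point_evalX.
  move=> i j; rewrite -wd_rmorph; apply: (@frac_neq0 _ one).
  by rewrite wd_rmorph !point_evalX.
have /eqP := condensation_generic gen.
rewrite -subr_eq0 -/(condensation_defect _ _ _ _) -condensation_defect_rmorph.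
rewrite -(rmorph0 (to_frac N)) (inj_eq (@frac_inj N)) => /eqP E.
pose v (k : 'I_N) : R := match split k with
  | inl k' => if k' == ord0 then x else y
  | inr k' => match split k' with inl i => z i | inr j => w j end end.
have EX : point_eval v X = x.
  by rewrite point_evalX /v (unsplitK (inl _)).
have EY : point_eval v Y = y.
  by rewrite point_evalX /v (unsplitK (inl _)).
have EZ i : point_eval v (Z i) = z i.
  by rewrite point_evalX /v (unsplitK (inr _)) (unsplitK (inl _)).
have EV i : point_eval v (V i) = w i.
  by rewrite point_evalX /v (unsplitK (inr _)) (unsplitK (inr _)).
have := congr1 (point_eval v) E; rewrite condensation_defect_rmorph rmorph0 EX EY => <-.
apply/eqP; rewrite /condensation_defect /sub_sum !EZ !EV.
congr (_ * _ * _ - (_ * _ * _ - _ * _ * _)); apply: eq_spectral_sum => k;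
  by rewrite ?EZ ?EV.
Qed.

(** * Refined generating functions as weighted sums *)

Section Line.
Variables (n : nat) (F : 'I_n -> int).
Hypotheses (F01 : forall j, F j \in [:: 0; 1]) (Fsum : \sum_j F j = 1).

Lemma line_ge0 j : 0 <= F j.
Proof. by have := F01 j; rewrite !inE => /orP[]/eqP->. Qed.

Lemma one_before j :
  [exists k : 'I_n, (k < j)%N && (F k == 1)] = (\sum_(k < n | (k < j)%N) F k != 0).
Proof.
rewrite psumr_eq0 => [|k _]; last exact: line_ge0.
apply/existsP/allPn => [[k /andP[kj /eqP Fk]]|[k _]].
  by exists k; rewrite ?mem_index_enum // kj Fk.
rewrite negb_imply => /andP[kj Fk0]; exists k; rewrite kj.
by have := F01 k; rewrite !inE (negPf Fk0).
Qed.

Lemma one_after j : F j = 0 ->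
  [exists k : 'I_n, (j < k)%N && (F k == 1)] = (\sum_(k < n | (k < j)%N) F k == 0).
Proof.
move=> Fj; have : \sum_(k < n | (k < j)%N) F k + \sum_(k < n | (j < k)%N) F k = 1.
  rewrite -[RHS]Fsum [RHS](bigID (fun k : 'I_n => (k < j)%N)) /=; congr (_ + _).
  rewrite [RHS](bigD1 j) ?ltnn //= Fj add0r; apply: eq_bigl => k.
  by rewrite -leqNgt ltn_neqAle andbC eq_sym.
have ge0 (P : pred 'I_n) : 0 <= \sum_(k | P k) F k by apply: sumr_ge0 => k _; apply: line_ge0.
have := ge0 (fun k : 'I_n => k < j)%N; set S := \sum_(_ | _) _ => S0.
set T := \sum_(_ | _) _ => ST.
have -> : [exists k : 'I_n, (j < k)%N && (F k == 1)] = (T != 0).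
  rewrite /T psumr_eq0 => [|k _]; last exact: line_ge0.
  apply/existsP/allPn => [[k /andP[kj /eqP Fk]]|[k _]].
    by exists k; rewrite ?mem_index_enum // kj Fk.
  rewrite negb_imply => /andP[kj Fk0]; exists k; rewrite kj.
  by have := F01 k; rewrite !inE (negPf Fk0).
have T0 : 0 <= T by apply: ge0.
by lia.
Qed.
End Line.

Section Stats.
Variables (n : nat) (A : asm n.+1).

Definition zero00 i j :=
  [&& A i j == 0, row_prefix A i j == 0 & col_prefix A i j == 0].
Definition zero11 i j :=
  [&& A i j == 0, row_prefix A i j != 0 & col_prefix A i j != 0].

Lemma asm_first_row j : A ord0 j \in [:: 0; 1].
Proof.
have := asm_col_prefix A 1 j.
by rewrite -[1%N]/(@ord0 n).+1 col_prefixS col_prefix0 add0r.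
Qed.

Lemma col_prefix_last j : col_prefix A (@ord_max n) j = 1 - A ord_max j.
Proof.
apply: (addIr (A ord_max j)); rewrite -col_prefixS subrK.
by rewrite col_prefix_full // asm_col_sum.
Qed.

Lemma row_prefix_last i : row_prefix A i (@ord_max n) = 1 - A i ord_max.
Proof.
apply: (addIr (A i ord_max)); rewrite -row_prefixS subrK.
by rewrite row_prefix_full // asm_row_sum.
Qed.

Lemma asm_last_row j : A ord_max j \in [:: 0; 1].
Proof.
have := asm_col_prefix A (@ord_max n) j; rewrite col_prefix_last !inE.
by move: (A _ _) => a; lia.
Qed.

Lemma asm_last_col i : A i ord_max \in [:: 0; 1].
Proof.
have := asm_row_prefix A i (@ord_max n); rewrite row_prefix_last !inE.
by move: (A _ _) => a; lia.
Qed.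

Lemma asm_first_col i : A i ord0 \in [:: 0; 1].
Proof.
have := asm_row_prefix A i 1.
by rewrite -[1%N]/(@ord0 n).+1 row_prefixS row_prefix0 add0r.
Qed.

Lemma card_sum_nat (T : finType) (P : pred T) : #|[set t | P t]| = (\sum_t P t)%N.
Proof.
rewrite -sum1_card big_mkcond; apply: eq_bigr => t _; rewrite inE.
by case: (P t).
Qed.

(** For a zero on the border one of the two prefix sums is known, so each border statistic counts
    the zeros of a single type in its line. The refinement can thus be absorbed into [a1] and
    [a2]. *)
Lemma rho_T_sum : rho_T A = (\sum_j zero00 ord0 j)%N.
Proof.
rewrite /rho_T /zeros_left_of_1 card_sum_nat; apply: eq_bigr => j _; congr nat_of_bool.
rewrite /zero00 col_prefix0 eqxx andbT; case: eqP => //= Aj.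
by rewrite one_after //; [exact: asm_first_row | exact: asm_row_sum].
Qed.

Lemma rho_L_sum : rho_L A = (\sum_i zero00 i ord0)%N.
Proof.
rewrite /rho_L /zeros_above_1 card_sum_nat; apply: eq_bigr => i _; congr nat_of_bool.
rewrite /zero00 row_prefix0 eqxx /=; case: eqP => //= Ai.
by rewrite (one_after (F := fun i => A i ord0)) //;
  [exact: asm_first_col | exact: asm_col_sum].
Qed.

Lemma rho_B_sum : rho_B A = (\sum_j zero11 ord_max j)%N.
Proof.
rewrite /rho_B /zeros_right_of_1 card_sum_nat; apply: eq_bigr => j _; congr nat_of_bool.
rewrite /zero11 col_prefix_last; case: eqP => //= Aj.
by rewrite Aj subr0 oner_eq0 andbT one_before //; exact: asm_last_row.
Qed.

Lemma rho_R_sum : rho_R A = (\sum_i zero11 i ord_max)%N.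
Proof.
rewrite /rho_R /zeros_below_1 card_sum_nat; apply: eq_bigr => i _; congr nat_of_bool.
rewrite /zero11 row_prefix_last; case: eqP => //= Ai.
rewrite Ai subr0 oner_eq0 (one_before (F := fun i => A i ord_max)) //.
exact: asm_last_col.
Qed.

Lemma mu_sum : mu A = (\sum_i \sum_j (A i j == -1)%R)%N.
Proof. by rewrite /mu card_sum_nat pair_big. Qed.

(** Grouping the quadruple sum by [i'] and [j] gives the column sum above the cell times the row sum
    up to and including it. At a 1 the first factor is 0, at a -1 the second is 0, and at a zero the
    product is [r * s]. *)
Lemma nu_sum : `|nu A|%N = (\sum_i \sum_j zero11 i j)%N.
Proof.
suff -> : nu A = (\sum_i \sum_j zero11 i j)%N by [].
rewrite (big_morph _ PoszD (erefl _)).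
rewrite /nu (exchange_big_dep predT) //=; apply: eq_bigr => i' _.
rewrite exchange_big (big_morph _ PoszD (erefl _)); apply: eq_bigr => j _.
transitivity (col_prefix A i' j * row_prefix A i' j.+1).
  by rewrite mulr_suml; apply: eq_bigr => i _; rewrite mulr_sumr.
rewrite row_prefixS /zero11; have := asm_row_prefix A i' j.+1.
have := asm_col_prefix A i'.+1 j; rewrite row_prefixS col_prefixS.
have := asm_entry A i' j; have := asm_row_prefix A i' j; have := asm_col_prefix A i' j.
by rewrite !inE => /orP[]/eqP-> /orP[]/eqP-> /or3P[]/eqP->.
Qed.

End Stats.

Definition at_first n (R : nzRingType) (t : R) (i : 'I_n.+1) : R :=
  if i == ord0 then t else 1.

Definition at_last n (R : nzRingType) (t : R) (i : 'I_n.+1) : R :=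
  if i == ord_max then t else 1.

(* [Zquad] with a factor [t1], [t2], [t3], [t4] for a zero in the top left, bottom
   right, top right, bottom left corner. *)
Definition corner_sum (R : comNzRingType) n (x y z1 z2 z3 z4 t1 t2 t3 t4 : R) : R :=
  asm_sum
    (scale_at ord0 ord0 t1 (fun i j : 'I_n.+1 => at_first z1 i * at_first z4 j))
    (scale_at ord_max ord_max t2 (fun i j => x * (at_last z3 i * at_last z2 j)))
    (scale_at ord0 ord_max t3 (fun _ _ => 1))
    (scale_at ord_max ord0 t4 (fun _ _ => 1))
    (fun _ _ => y).

Lemma Zquad_corner_sum (R : comNzRingType) n (x y z1 z2 z3 z4 : R) :
  Zquad n.+1 x y z1 z2 z3 z4 = corner_sum n x y z1 z2 z3 z4 1 1 1 1.
Proof.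
rewrite /Zquad /corner_sum /asm_sum; apply: eq_bigr => A _.
rewrite nu_sum mu_sum rho_T_sum rho_R_sum rho_B_sum rho_L_sum.
transitivity (\prod_i \prod_j (x ^+ zero11 A i j * y ^+ (A i j == -1) *
    z1 ^+ (zero00 A i j && (i == ord0)) * z2 ^+ (zero11 A i j && (j == ord_max)) *
    z3 ^+ (zero11 A i j && (i == ord_max)) * z4 ^+ (zero00 A i j && (j == ord0)))).
  under [RHS]eq_bigr => i _ do rewrite !big_split /= -!expr_sum.
  rewrite !big_split /= -!expr_sum; do !congr (_ * _); congr (_ ^+ _).
  - rewrite [RHS](bigD1 ord0) //= [X in (_ + X)%N]big1 ?addn0 => [|i i0].
      by apply: eq_bigr => j _; rewrite andbT.
    by rewrite big1 // => j _; rewrite (negPf i0) andbF.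
  - apply: eq_bigr => i _; rewrite [RHS](bigD1 ord_max) //=.
    rewrite [X in (_ + X)%N]big1 ?addn0 ?eqxx ?andbT // => j j0.
    by rewrite (negPf j0) andbF.
  - rewrite [RHS](bigD1 ord_max) //= [X in (_ + X)%N]big1 ?addn0 => [|i i0].
      by apply: eq_bigr => j _; rewrite eqxx andbT.
    by rewrite big1 // => j _; rewrite (negPf i0) andbF.
  apply: eq_bigr => i _; rewrite [RHS](bigD1 ord0) //=.
  rewrite [X in (_ + X)%N]big1 ?addn0 ?eqxx ?andbT // => j j0.
  by rewrite (negPf j0) andbF.
apply: eq_bigr => i _; apply: eq_bigr => j _; rewrite /scale_at !if_same /zero11 /zero00.
rewrite /entry_weight /at_first /at_last; have := asm_entry A i j; rewrite !inE.
case/or3P => /eqP-> /=; rewrite ?expr0 ?expr1 ?mulr1 ?mul1r //.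
by case: (row_prefix A i j == 0); case: (col_prefix A i j == 0);
  case: (i == ord0); case: (j == ord0);
  case: (i == ord_max); case: (j == ord_max); rewrite /= ?expr0 ?expr1 ?mulr1 ?mul1r; ring.
Qed.

(** * All four corners, weights that never occur, and the half-turn *)

Section Corners.
Variable R : comNzRingType.

Lemma rev_ord0 n : rev_ord (@ord0 n) = ord_max.
Proof. by apply: val_inj; rewrite /= subn1. Qed.

Lemma rev_ord_max n : rev_ord (@ord_max n) = ord0.
Proof. by rewrite -rev_ord0 rev_ordK. Qed.

Lemma rev_eq_max n (j : 'I_n.+1) : (rev_ord j == ord_max) = (j == ord0).
Proof. by rewrite -rev_ord0 (inj_eq rev_ord_inj). Qed.

Lemma rev_lift0 n (j : 'I_n) : rev_ord (lift ord0 j) = lift ord_max (rev_ord j).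
Proof. by apply: val_inj; rewrite /= /bump; have := ltn_ord j; lia. Qed.

Implicit Types t : R.

(** Reflection carries this corner to the top left and [b1] to [a1]; the two bottom corners then
    follow by a transposition and one more reflection. *)
Lemma asm_sum_scale_TR n t (a1 a2 b1 b2 c : 'I_n.+1 -> 'I_n.+1 -> R) :
  asm_sum a1 a2 (scale_at ord0 ord_max t b1) b2 c =
  t * asm_sum a1 a2 b1 b2 c +
  (1 - t) * ((\prod_j a1 ord0 (lift ord_max j)) * (\prod_i a2 (lift ord0 i) ord_max) *
    asm_sum (lift2 ord0 ord_max a1) (lift2 ord0 ord_max a2) (lift2 ord0 ord_max b1)
            (lift2 ord0 ord_max b2) (lift2 ord0 ord_max c)).
Proof.
rewrite asm_sum_flip.
transitivity (asm_sum (scale_at ord0 ord0 t (fun i j => b1 i (rev_ord j)))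
    (fun i j => b2 i (rev_ord j)) (fun i j => a1 i (rev_ord j))
    (fun i j => a2 i (rev_ord j)) (fun i j => c i (rev_ord j))).
  apply: eq_asm_sum => // i j.
  by rewrite /scale_at rev_eq_max.
rewrite asm_sum_scale_TL -asm_sum_flip; congr (_ + _ * (_ * _ * _)).
- rewrite [RHS](reindex_inj rev_ord_inj) /=.
  by apply: eq_bigr => j _; rewrite rev_lift0.
- by apply: eq_bigr => i _; rewrite rev_ord0.
by rewrite [RHS]asm_sum_flip; apply: eq_asm_sum => i j; rewrite /lift2 rev_lift0.
Qed.

Lemma asm_sum_scale_BL n t (a1 a2 b1 b2 c : 'I_n.+1 -> 'I_n.+1 -> R) :
  asm_sum a1 a2 b1 (scale_at ord_max ord0 t b2) c =
  t * asm_sum a1 a2 b1 b2 c +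
  (1 - t) * ((\prod_i a1 (lift ord_max i) ord0) * (\prod_j a2 ord_max (lift ord0 j)) *
    asm_sum (lift2 ord_max ord0 a1) (lift2 ord_max ord0 a2) (lift2 ord_max ord0 b1)
            (lift2 ord_max ord0 b2) (lift2 ord_max ord0 c)).
Proof.
rewrite asm_sum_tr.
transitivity (asm_sum (fun i j => a1 j i) (fun i j => a2 j i)
    (scale_at ord0 ord_max t (fun i j => b2 j i)) (fun i j => b1 j i) (fun i j => c j i)).
  by apply: eq_asm_sum => // i j; rewrite /scale_at andbC.
by rewrite asm_sum_scale_TR -asm_sum_tr; congr (_ + _ * (_ * _)); rewrite [RHS]asm_sum_tr.
Qed.

Lemma asm_sum_scale_BR n t (a1 a2 b1 b2 c : 'I_n.+1 -> 'I_n.+1 -> R) :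
  asm_sum a1 (scale_at ord_max ord_max t a2) b1 b2 c =
  t * asm_sum a1 a2 b1 b2 c +
  (1 - t) * ((\prod_i b1 (lift ord_max i) ord_max) * (\prod_j b2 ord_max (lift ord_max j)) *
    asm_sum (lift2 ord_max ord_max a1) (lift2 ord_max ord_max a2)
      (lift2 ord_max ord_max b1) (lift2 ord_max ord_max b2) (lift2 ord_max ord_max c)).
Proof.
rewrite asm_sum_flip.
transitivity (asm_sum (fun i j => b1 i (rev_ord j))
    (fun i j => b2 i (rev_ord j)) (fun i j => a1 i (rev_ord j))
    (scale_at ord_max ord0 t (fun i j => a2 i (rev_ord j))) (fun i j => c i (rev_ord j))).
  apply: eq_asm_sum => // i j.
  by rewrite /scale_at rev_eq_max.
rewrite asm_sum_scale_BL -asm_sum_flip; congr (_ + _ * (_ * _ * _)).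
- by apply: eq_bigr => i _; rewrite rev_ord0.
- rewrite [RHS](reindex_inj rev_ord_inj) /=.
  by apply: eq_bigr => j _; rewrite rev_lift0.
by rewrite [RHS]asm_sum_flip; apply: eq_asm_sum => i j; rewrite /lift2 rev_lift0.
Qed.

(** A zero has [s = 0] in the first row, [s = 1] in the last, [r = 0] in the first column and
    [r = 1] in the last, and no -1 lies on the border. The spectral and the refined weights may
    therefore disagree at these places. *)
Lemma eq_asm_sum_border n (a1 a2 b1 b2 c a1' a2' b1' b2' c' : 'I_n.+1 -> 'I_n.+1 -> R) :
  (forall i j, i != ord_max -> j != ord_max -> a1 i j = a1' i j) ->
  (forall i j, i != ord0 -> j != ord0 -> a2 i j = a2' i j) ->
  (forall i j, i != ord_max -> j != ord0 -> b1 i j = b1' i j) ->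
  (forall i j, i != ord0 -> j != ord_max -> b2 i j = b2' i j) ->
  (forall i j, i != ord0 -> i != ord_max -> j != ord0 -> j != ord_max ->
     c i j = c' i j) ->
  asm_sum a1 a2 b1 b2 c = asm_sum a1' a2' b1' b2' c'.
Proof.
move=> E1 E2 E3 E4 E5; apply: eq_bigr => A _; apply: eq_bigr => i _.
apply: eq_bigr => j _; rewrite /entry_weight.
case: eqP => // Aij1; case: eqP => [Aij|Aij0].
  have imax : col_prefix A i j = 0 -> i != ord_max.
    by move=> c0; apply: contraPneq c0 => Ei; rewrite Ei col_prefix_last -Ei Aij.
  have jmax : row_prefix A i j = 0 -> j != ord_max.
    by move=> r0; apply: contraPneq r0 => Ej; rewrite Ej row_prefix_last -Ej Aij.
  have i0 : col_prefix A i j != 0 -> i != ord0.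
    by apply: contraNneq => ->; rewrite col_prefix0.
  have j0 : row_prefix A i j != 0 -> j != ord0.
    by apply: contraNneq => ->; rewrite row_prefix0.
  case: (eqVneq (row_prefix A i j)) => [/jmax|/j0] hj;
    case: (eqVneq (col_prefix A i j)) => [/imax|/i0] hi.
  - exact: E1.
  - exact: E4.
  - exact: E3.
  - exact: E2.
have notin01 (B : 'I_n.+1 -> 'I_n.+1 -> int) : B i j \in [:: 0; 1] -> B i j = A i j -> False.
  by rewrite !inE => /orP[]/eqP-> E; [apply: Aij0 | apply: Aij1].
apply: E5; apply/eqP => E.
- by apply: (notin01 (fun _ j => A ord0 j)); rewrite ?E //; apply: asm_first_row.
- by apply: (notin01 (fun _ j => A ord_max j)); rewrite ?E //; apply: asm_last_row.
- by apply: (notin01 (fun i _ => A i ord0)); rewrite ?E //; apply: asm_first_col.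
by apply: (notin01 (fun i _ => A i ord_max)); rewrite ?E //; apply: asm_last_col.
Qed.

(** For fixed [j], summing over the rows adds up the [j] columns to the left, each of total 1. *)
Lemma sum_prefixes n (A : asm n) :
  \sum_(i < n) \sum_(j < n) row_prefix A i j = \sum_(j < n) (j : nat)%:Z.
Proof.
rewrite exchange_big; apply: eq_bigr => j _ /=.
rewrite /row_prefix exchange_big /=.
under eq_bigr => k _ do rewrite asm_col_sum.
by rewrite -(big_ord_widen n (fun=> 1 : int) (ltnW (ltn_ord j))) sumr_const card_ord natz.
Qed.

(* Sum [1 - r - s] over all entries: each of the prefix sums adds up to n(n-1)/2. *)
Lemma zeros_balanced n (A : asm n) :
  (\sum_i \sum_j [&& A i j == 0, row_prefix A i j == 0 & col_prefix A i j == 0] =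
   \sum_i \sum_j [&& A i j == 0, row_prefix A i j != 0 & col_prefix A i j != 0])%N.
Proof.
apply/eqP; rewrite -eqz_nat; apply/eqP.
have Z (f : 'I_n -> 'I_n -> bool) : (\sum_i \sum_j f i j)%N%:Z = \sum_i \sum_j (f i j)%:Z.
  by rewrite (big_morph _ PoszD (erefl _)); apply: eq_bigr => i _;
    rewrite (big_morph _ PoszD (erefl _)).
rewrite !Z; apply/eqP; rewrite -subr_eq0 -sumrB.
under eq_bigr => i _ do rewrite -sumrB.
rewrite (eq_bigr (fun i => \sum_(j < n)
  (1 - row_prefix A i j - col_prefix A i j - A i j))); last first.
  move=> i _; apply: eq_bigr => j _; have := asm_row_prefix A i j.+1.
  have := asm_col_prefix A i.+1 j; rewrite row_prefixS col_prefixS.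
  have := asm_entry A i j; have := asm_row_prefix A i j; have := asm_col_prefix A i j.
  by rewrite !inE => /orP[]/eqP-> /orP[]/eqP-> /or3P[]/eqP->.
under eq_bigr => i _ do rewrite !sumrB asm_row_sum.
rewrite !sumrB sum_prefixes.
have -> : \sum_(i < n) \sum_(j < n) col_prefix A i j = \sum_(j < n) (j : nat)%:Z.
  rewrite exchange_big /= -(sum_prefixes (asm_tr A)).
  by apply: eq_bigr => i _; apply: eq_bigr => j _; rewrite row_prefix_tr.
rewrite !sumr_const card_ord -(big_morph _ PoszD (erefl _)).
have S m : (\sum_(i < m) i + \sum_(i < m) i + m = m * m)%N.
  elim: m => [|m IHm]; first by rewrite !big_ord0.
  rewrite !big_ord_recr /= mulnS mulSn -IHm; set s := bigop _ _ _; lia.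
rewrite -mulr_natr !natz; have := S n; set s := (\sum_(i < n) i)%N.
by lia.
Qed.

(** Both types of zero are equally frequent, so [x] may sit on either. A half-turn exchanges the two
    types, and this restores [x] to its place. *)
Lemma asm_sum_gauge n (x : R) (a1 a2 b1 b2 c : 'I_n -> 'I_n -> R) :
  asm_sum a1 (fun i j => x * a2 i j) b1 b2 c = asm_sum (fun i j => x * a1 i j) a2 b1 b2 c.
Proof.
apply: eq_bigr => A _; rewrite /asm_weight.
pose W i j := entry_weight (a1 i j) (a2 i j) (b1 i j) (b2 i j) (c i j)
  (row_prefix A i j) (col_prefix A i j) (A i j).
transitivity (\prod_i \prod_j
   (x ^+ [&& A i j == 0, row_prefix A i j != 0 & col_prefix A i j != 0] * W i j)).
  apply: eq_bigr => i _; apply: eq_bigr => j _; rewrite /W /entry_weight.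
  have := asm_entry A i j; rewrite !inE => /or3P[]/eqP-> /=; rewrite ?mul1r //.
  by do 2!case: eqP => _ /=; rewrite ?expr0 ?expr1 ?mul1r.
transitivity (\prod_i \prod_j
   (x ^+ [&& A i j == 0, row_prefix A i j == 0 & col_prefix A i j == 0] * W i j)); last first.
  apply: eq_bigr => i _; apply: eq_bigr => j _; rewrite /W /entry_weight.
  have := asm_entry A i j; rewrite !inE => /or3P[]/eqP-> /=; rewrite ?mul1r //.
  by do 2!case: eqP => _ /=; rewrite ?expr0 ?expr1 ?mul1r.
under eq_bigr => i _ do rewrite big_split /= -expr_sum.
under [RHS]eq_bigr => i _ do rewrite big_split /= -expr_sum.
by rewrite !big_split /= -!expr_sum zeros_balanced.
Qed.

End Corners.

Section CornerSum.
Variables (R : comNzRingType) (x y : R).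

Lemma at_first_rev n (t : R) (i : 'I_n.+1) : at_first t (rev_ord i) = at_last t i.
Proof. by rewrite /at_first /at_last -(rev_ord_max n) (inj_eq rev_ord_inj). Qed.

Lemma at_last_rev n (t : R) (i : 'I_n.+1) : at_last t (rev_ord i) = at_first t i.
Proof. by rewrite /at_first /at_last rev_eq_max. Qed.

Lemma Zquad_asm_sum n z1 z2 z3 z4 :
  Zquad n.+1 x y z1 z2 z3 z4 =
  asm_sum (fun i j : 'I_n.+1 => at_first z1 i * at_first z4 j)
    (fun i j => x * (at_last z3 i * at_last z2 j))
    (fun _ _ => 1) (fun _ _ => 1) (fun _ _ => y).
Proof.
by rewrite Zquad_corner_sum; apply: eq_asm_sum => i j; rewrite /scale_at ?if_same ?mul1r.
Qed.

Lemma Zquad_tr n z1 z2 z3 z4 : Zquad n x y z1 z2 z3 z4 = Zquad n x y z4 z3 z2 z1.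
Proof.
case: n => [|n].
  by rewrite /Zquad; apply: eq_bigr => A _; rewrite /= !expr0.
rewrite !Zquad_asm_sum asm_sum_tr; apply: eq_asm_sum => i j //.
- exact: mulrC.
- by congr (_ * _); apply: mulrC.
Qed.

(** A reflection followed by a transposition is a quarter-turn; done twice, it is the half-turn. *)
Lemma Zquad_rot n z1 z2 z3 z4 : Zquad n x y z1 z2 z3 z4 = Zquad n x y z3 z4 z1 z2.
Proof.
case: n => [|n].
  by rewrite /Zquad; apply: eq_bigr => A _; rewrite /= !expr0.
rewrite !Zquad_asm_sum asm_sum_flip asm_sum_tr asm_sum_flip asm_sum_tr [RHS]asm_sum_gauge.
by apply: eq_asm_sum => i j; rewrite ?at_first_rev ?at_last_rev.
Qed.

Lemma Zasm_asm_sum n :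
  Zasm n x y = asm_sum (fun _ _ : 'I_n => 1) (fun _ _ => x) (fun _ _ => 1) (fun _ _ => 1)
    (fun _ _ => y).
Proof.
case: n => [|n]; first by rewrite Zasm0 asm_sum0.
rewrite /Zasm Zquad_asm_sum; apply: eq_asm_sum => i j;
  by rewrite /at_first /at_last ?if_same ?mulr1 /= ?mulr1.
Qed.

End CornerSum.

(** * Expansion according to the corners that hold a 1 *)

Section CornerExpansion.
Variables (R : comNzRingType) (x y : R).

Lemma prod_at_first n (c t : R) : \prod_(i < n.+1) (c * at_first t i) = c ^+ n.+1 * t.
Proof.
rewrite big_split /= prodr_const card_ord (bigD1 ord0) //= big1 /at_first ?mulr1 //.
by move=> i /negPf->.
Qed.

Lemma prod_at_last n (c t : R) : \prod_(i < n.+1) (c * at_last t i) = c ^+ n.+1 * t.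
Proof.
rewrite big_split /= prodr_const card_ord (bigD1 ord_max) //= big1 /at_last ?eqxx ?mulr1 //.
by move=> i /negPf->.
Qed.

Lemma prod_at_first1 n (t : R) : \prod_(i < n.+1) at_first t i = t.
Proof.
have := prod_at_first n 1 t; rewrite expr1n mul1r => E; rewrite -[RHS]E.
by apply: eq_bigr => i _; rewrite mul1r.
Qed.

Lemma prod_at_last1 n (t : R) : \prod_(i < n.+1) at_last t i = t.
Proof.
have := prod_at_last n 1 t; rewrite expr1n mul1r => E; rewrite -[RHS]E.
by apply: eq_bigr => i _; rewrite mul1r.
Qed.

Lemma at_first0 n (t : R) : at_first t (@ord0 n) = t.
Proof. by []. Qed.

Lemma at_last_max n (t : R) : at_last t (@ord_max n) = t.
Proof. by rewrite /at_last eqxx. Qed.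

Lemma at_first1 n (i : 'I_n.+1) : at_first (1 : R) i = 1.
Proof. exact: if_same. Qed.

Lemma at_last1 n (i : 'I_n.+1) : at_last (1 : R) i = 1.
Proof. exact: if_same. Qed.

Lemma at_first_lift0 n t (i : 'I_n) : at_first t (lift ord0 i) = 1 :> R.
Proof. by []. Qed.

Lemma at_last_lift_max n t (i : 'I_n) : at_last t (lift ord_max i) = 1 :> R.
Proof. by rewrite /at_last lift_eqF. Qed.

Lemma at_first_lift_max n t (i : 'I_n.+1) : at_first t (lift ord_max i) = at_first t i :> R.
Proof. by rewrite /at_first lift_max_eq0. Qed.

Lemma at_last_lift0 n t (i : 'I_n.+1) : at_last t (lift ord0 i) = at_last t i :> R.
Proof. by rewrite /at_last lift0_eq_max. Qed.

Definition atE := (at_first0, at_last_max, at_first1, at_last1, at_first_lift0,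
  at_last_lift_max, at_first_lift_max, at_last_lift0,
  lift_eqF, eq_liftF, lift0_eq_max, lift_max_eq0,
  eqxx, andbT, andbF, if_same, mul1r, mulr1).

Lemma corner_sum_TL n z1 z2 z3 z4 t1 t2 t3 t4 :
  corner_sum n.+1 x y z1 z2 z3 z4 t1 t2 t3 t4 =
  t1 * corner_sum n.+1 x y z1 z2 z3 z4 1 t2 t3 t4 +
  (1 - t1) * (t3 * t4 * corner_sum n x y 1 z2 z3 1 1 t2 1 1).
Proof.
rewrite {1}/corner_sum asm_sum_scale_TL; congr (_ * _ + _ * (_ * _ * _)).
- by apply: eq_asm_sum => i j; rewrite /scale_at ?atE.
- by rewrite -[RHS](prod_at_last1 n); apply: eq_bigr => j _; rewrite /scale_at ?atE.
- by rewrite -[RHS](prod_at_last1 n); apply: eq_bigr => j _; rewrite /scale_at ?atE.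
by apply: eq_asm_sum => i j; rewrite /lift2 /scale_at ?atE.
Qed.

Lemma corner_sum_BR n z1 z2 z3 z4 t2 t3 t4 :
  corner_sum n.+1 x y z1 z2 z3 z4 1 t2 t3 t4 =
  t2 * corner_sum n.+1 x y z1 z2 z3 z4 1 1 t3 t4 +
  (1 - t2) * (t3 * t4 * corner_sum n x y z1 1 1 z4 1 1 1 1).
Proof.
rewrite {1}/corner_sum asm_sum_scale_BR; congr (_ * _ + _ * (_ * _ * _)).
- by apply: eq_asm_sum => i j; rewrite /scale_at ?atE.
- by rewrite -[RHS](prod_at_first1 n); apply: eq_bigr => j _; rewrite /scale_at ?atE.
- by rewrite -[RHS](prod_at_first1 n); apply: eq_bigr => j _; rewrite /scale_at ?atE.
by apply: eq_asm_sum => i j; rewrite /lift2 /scale_at ?atE.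
Qed.

Lemma corner_sum_TR n z1 z2 z3 z4 t3 t4 :
  corner_sum n.+1 x y z1 z2 z3 z4 1 1 t3 t4 =
  t3 * corner_sum n.+1 x y z1 z2 z3 z4 1 1 1 t4 +
  (1 - t3) * (z1 ^+ n.+1 * z4 * ((x * z2) ^+ n.+1 * z3) *
    corner_sum n x y 1 1 z3 z4 1 1 1 t4).
Proof.
rewrite {1}/corner_sum asm_sum_scale_TR; congr (_ * _ + _ * (_ * _ * _)).
- by apply: eq_asm_sum => i j; rewrite /scale_at ?atE.
- by rewrite -prod_at_first; apply: eq_bigr => j _; rewrite /scale_at ?atE.
- by rewrite -prod_at_last; apply: eq_bigr => j _; rewrite /scale_at ?atE; ring.
by apply: eq_asm_sum => i j; rewrite /lift2 /scale_at ?atE.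
Qed.

Lemma corner_sum_BL n z1 z2 z3 z4 t4 :
  corner_sum n.+1 x y z1 z2 z3 z4 1 1 1 t4 =
  t4 * corner_sum n.+1 x y z1 z2 z3 z4 1 1 1 1 +
  (1 - t4) * (z4 ^+ n.+1 * z1 * ((x * z3) ^+ n.+1 * z2) *
    corner_sum n x y z1 z2 1 1 1 1 1 1).
Proof.
rewrite {1}/corner_sum asm_sum_scale_BL; congr (_ * _ + _ * (_ * _ * _)).
- by apply: eq_asm_sum => i j; rewrite /scale_at ?atE.
- by rewrite -prod_at_first; apply: eq_bigr => j _; rewrite /scale_at ?atE; ring.
- by rewrite -prod_at_last; apply: eq_bigr => j _; rewrite /scale_at ?atE; ring.
by apply: eq_asm_sum => i j; rewrite /lift2 /scale_at ?atE.
Qed.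

Lemma corner_sum_TL1 n z1 z4 t :
  corner_sum n x y z1 1 1 z4 t 1 1 1 =
  t * corner_sum n x y z1 1 1 z4 1 1 1 1 + (1 - t) * Zasm n x y.
Proof.
rewrite {1}/corner_sum asm_sum_scale_TL !big1 ?mul1r; last 2 first.
- by move=> i _; rewrite /scale_at ?atE.
- by move=> i _; rewrite /scale_at ?atE.
rewrite Zasm_asm_sum; congr (_ * _ + _ * _);
  by apply: eq_asm_sum => i j; rewrite /lift2 /scale_at ?atE.
Qed.

Lemma corner_sum_BR1 n z2 z3 t :
  corner_sum n x y 1 z2 z3 1 1 t 1 1 =
  t * corner_sum n x y 1 z2 z3 1 1 1 1 1 + (1 - t) * Zasm n x y.
Proof.
rewrite {1}/corner_sum asm_sum_scale_BR !big1 ?mul1r; last 2 first.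
- by move=> i _; rewrite /scale_at ?atE.
- by move=> i _; rewrite /scale_at ?atE.
rewrite Zasm_asm_sum; congr (_ * _ + _ * _);
  by apply: eq_asm_sum => i j; rewrite /lift2 /scale_at ?atE.
Qed.

Lemma corner_sum_TR1 n z1 z2 t :
  corner_sum n x y z1 z2 1 1 1 1 t 1 =
  t * corner_sum n x y z1 z2 1 1 1 1 1 1 +
  (1 - t) * (z1 ^+ n * (x * z2) ^+ n * Zasm n x y).
Proof.
rewrite {1}/corner_sum asm_sum_scale_TR Zasm_asm_sum.
have pow (c : R) : \prod_(i < n) c = c ^+ n by rewrite prodr_const card_ord.
congr (_ * _ + _ * (_ * _ * _)).
- by apply: eq_asm_sum => i j; rewrite /scale_at ?atE.
- by rewrite -pow; apply: eq_bigr => j _; rewrite /scale_at ?atE.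
- by rewrite -pow; apply: eq_bigr => j _; rewrite /scale_at ?atE.
by apply: eq_asm_sum => i j; rewrite /lift2 /scale_at ?atE.
Qed.

Lemma corner_sum_BL1 n z3 z4 t :
  corner_sum n x y 1 1 z3 z4 1 1 1 t =
  t * corner_sum n x y 1 1 z3 z4 1 1 1 1 +
  (1 - t) * (z4 ^+ n * (x * z3) ^+ n * Zasm n x y).
Proof.
rewrite {1}/corner_sum asm_sum_scale_BL Zasm_asm_sum.
have pow (c : R) : \prod_(i < n) c = c ^+ n by rewrite prodr_const card_ord.
congr (_ * _ + _ * (_ * _ * _)).
- by apply: eq_asm_sum => i j; rewrite /scale_at ?atE.
- by rewrite -pow; apply: eq_bigr => j _; rewrite /scale_at ?atE.
- by rewrite -pow; apply: eq_bigr => j _; rewrite /scale_at ?atE.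
by apply: eq_asm_sum => i j; rewrite /lift2 /scale_at ?atE.
Qed.

End CornerExpansion.

(** * Specialisation of the condensation identity *)

Section Refined.
Variables (F : fieldType) (x y : F).
Hypothesis y0 : y != 0.

(** Only at a corner do a row and a column parameter different from 1 meet. The four marks are the
    ratios there of the true weight to the product form [y * z1 * z4], [y * z3 * z2] or [y], the
    factor [x] of the type (1, 1) being left aside. *)
Lemma spectral_sum_refined n z1 z2 z3 z4 :
  z1 != 0 -> z2 != 0 -> z3 != 0 -> z4 != 0 ->
  spectral_sum x y (fun i : 'I_n.+1 => at_first z1 i * at_last z3 i)
                   (fun j => at_first z4 j * at_last z2 j) =
  y ^+ (n.+1 * n.+1 - n.+1) * corner_sum n x y z1 z2 z3 z4
    (wA y z1 z4 / (y * z1 * z4)) (wA y z3 z2 / (y * z3 * z2))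
    (wB x y z1 z2 / y) (wB x y z3 z4 / y).
Proof.
move=> nz1 nz2 nz3 nz4; rewrite /corner_sum -asm_sum_scale.
rewrite /at_first /at_last; apply: eq_asm_sum_border => i j.
- move=> /negPf-> /negPf->; rewrite /scale_at.
  by case: (i == ord0); case: (j == ord0); rewrite /= /wA ?mulr1; field; rewrite ?y0 ?nz1 ?nz4.
- move=> /negPf-> /negPf->; rewrite /scale_at.
  by case: (i == ord_max); case: (j == ord_max); rewrite /= /wA ?mulr1; field;
    rewrite ?y0 ?nz3 ?nz2.
- move=> /negPf-> /negPf->; rewrite /scale_at.
  by case: (i == ord0); case: (j == ord_max); rewrite /= /wB ?mulr1; field; rewrite ?y0.
- move=> /negPf-> /negPf->; rewrite /scale_at.
  by case: (i == ord_max); case: (j == ord0); rewrite /= /wB ?mulr1; field; rewrite ?y0.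
by move=> /negPf-> /negPf-> /negPf-> /negPf->; rewrite /wf; ring.
Qed.

Lemma spectral_sum_const n :
  spectral_sum x y (fun _ : 'I_n => 1) (fun _ => 1) = y ^+ (n * n - n) * Zasm n x y.
Proof.
rewrite Zasm_asm_sum -asm_sum_scale; apply: eq_asm_sum => i j; rewrite /wA /wB /wf; ring.
Qed.

Lemma Zadj_tr n z1 z2 : Zadj n x y z1 z2 = Zadj n x y z2 z1.
Proof. exact: Zquad_tr. Qed.

Lemma Zadj_rot n z2 z3 : Zquad n x y 1 z2 z3 1 = Zadj n x y z2 z3.
Proof. by rewrite Zquad_rot Zquad_tr. Qed.

Lemma Zadj_tilde_rot n z3 z4 : Zquad n x y 1 1 z3 z4 = Zadj_tilde n x y z3 z4.
Proof. exact: Zquad_rot. Qed.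

Lemma quad_relation_generic n z1 z2 z3 z4 :
  z1 != 0 -> z2 != 0 -> z3 != 0 -> z4 != 0 ->
  wA y z1 z4 != 0 -> wA y z3 z2 != 0 -> wB x y z1 z2 != 0 -> wB x y z3 z4 != 0 ->
  y * (z4 - z2) * (z1 - z3) * Zquad n.+2 x y z1 z2 z3 z4 * Zasm n x y =
    ((z1 - 1) * (z2 - 1) - y * z1 * z2) * ((z3 - 1) * (z4 - 1) - y * z3 * z4)
      * Zadj n.+1 x y z4 z1 * Zadj n.+1 x y z2 z3
  - (x * (z4 - 1) * (z1 - 1) - y) * (x * (z2 - 1) * (z3 - 1) - y)
      * z1 * z2 * z3 * z4
      * Zadj_tilde n.+1 x y z1 z2 * Zadj_tilde n.+1 x y z3 z4
  - (z2 - 1) * (z3 - 1) * ((z4 - 1) * (z1 - 1) - y * z4 * z1)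
      * Zadj n.+1 x y z4 z1 * Zasm n x y
  + (z3 - 1) * (z4 - 1) * (x * (z1 - 1) * (z2 - 1) - y)
      * z1 * z2 * (x * z3 * z4) ^+ n.+1
      * Zadj_tilde n.+1 x y z1 z2 * Zasm n x y
  - (z4 - 1) * (z1 - 1) * ((z2 - 1) * (z3 - 1) - y * z2 * z3)
      * Zadj n.+1 x y z2 z3 * Zasm n x y
  + (z1 - 1) * (z2 - 1) * (x * (z3 - 1) * (z4 - 1) - y)
      * z3 * z4 * (x * z1 * z2) ^+ n.+1
      * Zadj_tilde n.+1 x y z3 z4 * Zasm n x y
  + (z1 - 1) * (z2 - 1) * (z3 - 1) * (z4 - 1)
      * (1 - (x ^+ 2 * z1 * z2 * z3 * z4) ^+ n.+1)
      * Zasm n x y ^+ 2.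
Proof.
move=> nz1 nz2 nz3 nz4 A14 A32 B12 B34.
pose z (i : 'I_n.+2) := at_first z1 i * at_last z3 i.
pose w (j : 'I_n.+2) := at_first z4 j * at_last z2 j.
have one0 : (1 : F) != 0 := oner_neq0 F.
have sub (i j : 'I_n.+2) s1 s2 s3 s4 :
    (forall k, z (lift i k) = at_first s1 k * at_last s3 k) ->
    (forall k, w (lift j k) = at_first s4 k * at_last s2 k) ->
    s1 != 0 -> s2 != 0 -> s3 != 0 -> s4 != 0 ->
  sub_sum x y z w i j = y ^+ (n.+1 * n.+1 - n.+1) * corner_sum n x y s1 s2 s3 s4
    (wA y s1 s4 / (y * s1 * s4)) (wA y s3 s2 / (y * s3 * s2))
    (wB x y s1 s2 / y) (wB x y s3 s4 / y).
  by move=> Ez Ew h1 h2 h3 h4; rewrite -spectral_sum_refined //; apply: eq_spectral_sum.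
have zl k : z (lift ord_max k) = at_first z1 k * at_last 1 k.
  by rewrite /z !atE.
have z0 k : z (lift ord0 k) = at_first 1 k * at_last z3 k.
  by rewrite /z !atE.
have wl k : w (lift ord_max k) = at_first z4 k * at_last 1 k.
  by rewrite /w !atE.
have w0 k : w (lift ord0 k) = at_first 1 k * at_last z2 k.
  by rewrite /w !atE.
(* In each corner minor two of the four border parameters are 1, so three of its four marks are
   trivial and one expansion per minor is enough. *)
have wB1l u : wB x y 1 u / y = 1 by rewrite /wB; field.
have wB1r u : wB x y u 1 / y = 1 by rewrite /wB; field.
have := condensation x y z w.
rewrite (sub _ _ _ _ _ _ zl wl) // (sub _ _ _ _ _ _ z0 w0) //.
rewrite (sub _ _ _ _ _ _ z0 wl) // (sub _ _ _ _ _ _ zl w0) //.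
rewrite (spectral_sum_refined n.+1 nz1 nz2 nz3 nz4).
rewrite (eq_spectral_sum x y (z' := fun=> 1) (w' := fun=> 1)); last 2 first.
- by move=> k; rewrite z0 !atE.
- by move=> k; rewrite w0 !atE.
have wA1l u : u != 0 -> wA y 1 u / (y * 1 * u) = 1.
  by move=> u0; rewrite /wA; field; rewrite ?y0 ?u0.
have wA1r u : u != 0 -> wA y u 1 / (y * u * 1) = 1.
  by move=> u0; rewrite /wA; field; rewrite ?y0 ?u0.
rewrite spectral_sum_const !wB1l !wB1r !(wA1l, wA1r) //.
have -> : z ord_max = z3 by rewrite /z /at_first /at_last eqxx mul1r.
have -> : z ord0 = z1 by rewrite /z /at_first /at_last mulr1.
have -> : w ord_max = z2 by rewrite /w /at_first /at_last eqxx mul1r.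
have -> : w ord0 = z4 by rewrite /w /at_first /at_last mulr1.
rewrite corner_sum_TL corner_sum_BR corner_sum_TR corner_sum_BL.
rewrite (corner_sum_TL1 _ _ _ _ _ (wA y z1 z4 / _)).
rewrite (corner_sum_BR1 _ _ _ _ _ (wA y z3 z2 / _)).
rewrite (corner_sum_TR1 _ _ _ _ _ (wB x y z1 z2 / _)).
rewrite (corner_sum_BL1 _ _ _ _ _ (wB x y z3 z4 / _)).
rewrite -!Zquad_corner_sum Zadj_rot Zadj_tilde_rot.
rewrite -/(Zadj n.+1 x y z1 z4) -/(Zadj_tilde n.+1 x y z1 z2) (Zadj_tr _ z1).
set Q := Zquad _ _ _ _ _ _ _; set Z := Zasm _ _ _.
set P14 := Zadj _ _ _ _ _; set P23 := Zadj _ _ _ _ _.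
set T12 := Zadj_tilde _ _ _ _ _; set T34 := Zadj_tilde _ _ _ _ _.
have EY : y ^+ (n.+2 * n.+2 - n.+2) * y ^+ (n * n - n) =
    y ^+ 2 * y ^+ (n.+1 * n.+1 - n.+1) ^+ 2.
  by rewrite -exprD -exprM -exprD; congr (_ ^+ _); case: (n) => // m; lia.
set K1 := y ^+ (n.+1 * n.+1 - n.+1); set K2 := y ^+ (_ * _ - _).
set K0 := y ^+ (_ * _ - _); rewrite -/K2 -/K1 -/K0 in EY *.
have K10 : K1 ^+ 2 != 0 by rewrite !expf_neq0.
rewrite !exprMn !(exprS _ n).
move: (x ^+ n) (z1 ^+ n) (z2 ^+ n) (z3 ^+ n) (z4 ^+ n) => X U1 U2 U3 U4.
rewrite {sub zl z0 wl w0 wB1l wB1r wA1l wA1r z w one0}.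
set f1 := wA y z1 z4 / _; set f2 := wA y z3 z2 / _.
set f3 := wB x y z1 z2 / _; set f4 := wB x y z3 z4 / _.
set C := f1 * _ + _ => E.
have {}E : y ^+ 3 * (z3 - z1) * (z2 - z4) * C * Z =
    wAB x y z1 z2 * wAB x y z3 z4 *
    (f1 * P14 + (1 - f1) * Z) * (f2 * P23 + (1 - f2) * Z) -
    wAB x y z1 z4 * wAB x y z3 z2 *
    (f4 * T34 + (1 - f4) * (U4 * (X * U3) * Z)) *
    (f3 * T12 + (1 - f3) * (U1 * (X * U2) * Z)).
  apply: (mulfI K10); move: C E EY; clearbody K1 K2 K0 f1 f2 f3 f4 => C E EY.
  transitivity (y * (z3 - z1) * (z2 - z4) * (y ^+ 2 * K1 ^+ 2) * C * Z); first by ring.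
  transitivity (y * (z3 - z1) * (z2 - z4) * (K2 * C) * (K0 * Z)); first by rewrite -EY; ring.
  by rewrite E; ring.
(* This is the coefficient of [Q] in the expanded [C]; the factor [y ^+ 2] accounts for [y ^+ 3] in
   [E] against [y] in the goal. *)
pose p := f1 * f2 * f3 * f4.
have p0 : y ^+ 2 * p != 0.
  by rewrite /p /f1 /f2 /f3 /f4 !mulf_neq0 ?expf_neq0 ?invr_neq0 ?mulf_neq0.
apply: (mulfI p0); apply/eqP; rewrite -subr_eq0; apply/eqP.
(* One zero is replaced by the difference of the two sides of [E], which turns the goal into an
   identity of rational functions. *)
transitivity (0 - 0 : F); last by rewrite subrr.
move/eqP: E; rewrite -subr_eq0 => /eqP E; rewrite -{1}E subr0.
rewrite /p /C /f1 /f2 /f3 /f4 /wAB /wA /wB.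
by field; rewrite ?y0 ?nz1 ?nz2 ?nz3 ?nz4.
Qed.
End Refined.

Lemma Zquad_rmorph (R S : comNzRingType) (phi : {rmorphism R -> S}) n
    (x y z1 z2 z3 z4 : R) :
  phi (Zquad n x y z1 z2 z3 z4) =
  Zquad n (phi x) (phi y) (phi z1) (phi z2) (phi z3) (phi z4).
Proof.
rewrite rmorph_sum; apply: eq_bigr => A _.
by rewrite !rmorphM !rmorphXn.
Qed.

Definition quad_defect (R : comNzRingType) n (x y z1 z2 z3 z4 : R) : R :=
  y * (z4 - z2) * (z1 - z3) * Zquad n.+2 x y z1 z2 z3 z4 * Zasm n x y -
  (((z1 - 1) * (z2 - 1) - y * z1 * z2) * ((z3 - 1) * (z4 - 1) - y * z3 * z4)
      * Zadj n.+1 x y z4 z1 * Zadj n.+1 x y z2 z3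
  - (x * (z4 - 1) * (z1 - 1) - y) * (x * (z2 - 1) * (z3 - 1) - y)
      * z1 * z2 * z3 * z4
      * Zadj_tilde n.+1 x y z1 z2 * Zadj_tilde n.+1 x y z3 z4
  - (z2 - 1) * (z3 - 1) * ((z4 - 1) * (z1 - 1) - y * z4 * z1)
      * Zadj n.+1 x y z4 z1 * Zasm n x y
  + (z3 - 1) * (z4 - 1) * (x * (z1 - 1) * (z2 - 1) - y)
      * z1 * z2 * (x * z3 * z4) ^+ n.+1
      * Zadj_tilde n.+1 x y z1 z2 * Zasm n x y
  - (z4 - 1) * (z1 - 1) * ((z2 - 1) * (z3 - 1) - y * z2 * z3)
      * Zadj n.+1 x y z2 z3 * Zasm n x y
  + (z1 - 1) * (z2 - 1) * (x * (z3 - 1) * (z4 - 1) - y)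
      * z3 * z4 * (x * z1 * z2) ^+ n.+1
      * Zadj_tilde n.+1 x y z3 z4 * Zasm n x y
  + (z1 - 1) * (z2 - 1) * (z3 - 1) * (z4 - 1)
      * (1 - (x ^+ 2 * z1 * z2 * z3 * z4) ^+ n.+1)
      * Zasm n x y ^+ 2).

Lemma quad_defect_rmorph (R S : comNzRingType) (phi : {rmorphism R -> S}) n
    (x y z1 z2 z3 z4 : R) :
  phi (quad_defect n x y z1 z2 z3 z4) =
  quad_defect n (phi x) (phi y) (phi z1) (phi z2) (phi z3) (phi z4).
Proof.
have Eadj m u v : phi (Zadj m x y u v) = Zadj m (phi x) (phi y) (phi u) (phi v).
  by rewrite /Zadj Zquad_rmorph rmorph1.
have Etilde m u v : phi (Zadj_tilde m x y u v) = Zadj_tilde m (phi x) (phi y) (phi u) (phi v).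
  by rewrite /Zadj_tilde Zquad_rmorph rmorph1.
have Easm m : phi (Zasm m x y) = Zasm m (phi x) (phi y).
  by rewrite /Zasm Zquad_rmorph rmorph1.
rewrite /quad_defect -!Eadj -!Etilde -!Easm -!Zquad_rmorph -!(rmorph1 phi).
by do !rewrite -?rmorphXn -?rmorphM -?rmorphB -?rmorphD.
Qed.

(** In the fraction field of the polynomial ring in six indeterminates all required inverses exist.
    Evaluation then reaches the values excluded before, such as [y = 0] or a vanishing corner
    weight. *)
Lemma quad_defect_eq0 (R : comNzRingType) n (x y z1 z2 z3 z4 : R) :
  quad_defect n x y z1 z2 z3 z4 = 0.
Proof.
pose X (k : nat) : {mpoly int[6]} := 'X_(inord k).
pose v (k : 'I_6) := nth 0 [:: x; y; z1; z2; z3; z4] k.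
have E : quad_defect n (X 0) (X 1) (X 2) (X 3) (X 4) (X 5) = 0.
  apply: (@frac_inj 6); rewrite rmorph0 quad_defect_rmorph; apply/eqP; rewrite subr_eq0.
  apply/eqP; pose one : 'I_6 -> int := fun=> 1.
  have nz k : to_frac 6 (X k) != 0 by apply: (@frac_neq0 _ one); rewrite point_evalX.
  have wA0 i j k : wA (to_frac 6 (X i)) (to_frac 6 (X j)) (to_frac 6 (X k)) != 0.
    rewrite /wA -(rmorph1 (to_frac 6)) -!rmorphB -!rmorphM -rmorphB.
    apply: (@frac_neq0 _ one).
    by rewrite rmorphB !rmorphM !rmorphB rmorph1 !point_evalX.
  have wB0 i j k l : wB (to_frac 6 (X i)) (to_frac 6 (X j)) (to_frac 6 (X k))
      (to_frac 6 (X l)) != 0.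
    rewrite /wB -(rmorph1 (to_frac 6)) -!rmorphB -!rmorphM -rmorphB.
    apply: (@frac_neq0 _ one).
    by rewrite rmorphB !rmorphM !rmorphB rmorph1 !point_evalX.
  exact: quad_relation_generic.
have := congr1 (point_eval v) E; rewrite quad_defect_rmorph rmorph0.
by rewrite !point_evalX /v !inordK.
Qed.

Theorem theorem1 (R : comNzRingType) (x y z1 z2 z3 z4 : R) (n : nat)
    (hn : (2 <= n)%N) :
  y * (z4 - z2) * (z1 - z3) * Zquad n x y z1 z2 z3 z4 * Zasm (n - 2) x y =
    ((z1 - 1) * (z2 - 1) - y * z1 * z2) * ((z3 - 1) * (z4 - 1) - y * z3 * z4)
      * Zadj (n - 1) x y z4 z1 * Zadj (n - 1) x y z2 z3
  - (x * (z4 - 1) * (z1 - 1) - y) * (x * (z2 - 1) * (z3 - 1) - y)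
      * z1 * z2 * z3 * z4
      * Zadj_tilde (n - 1) x y z1 z2 * Zadj_tilde (n - 1) x y z3 z4
  - (z2 - 1) * (z3 - 1) * ((z4 - 1) * (z1 - 1) - y * z4 * z1)
      * Zadj (n - 1) x y z4 z1 * Zasm (n - 2) x y
  + (z3 - 1) * (z4 - 1) * (x * (z1 - 1) * (z2 - 1) - y)
      * z1 * z2 * (x * z3 * z4) ^+ (n - 1)
      * Zadj_tilde (n - 1) x y z1 z2 * Zasm (n - 2) x y
  - (z4 - 1) * (z1 - 1) * ((z2 - 1) * (z3 - 1) - y * z2 * z3)
      * Zadj (n - 1) x y z2 z3 * Zasm (n - 2) x y
  + (z1 - 1) * (z2 - 1) * (x * (z3 - 1) * (z4 - 1) - y)
      * z3 * z4 * (x * z1 * z2) ^+ (n - 1)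
      * Zadj_tilde (n - 1) x y z3 z4 * Zasm (n - 2) x y
  + (z1 - 1) * (z2 - 1) * (z3 - 1) * (z4 - 1)
      * (1 - (x ^+ 2 * z1 * z2 * z3 * z4) ^+ (n - 1))
      * Zasm (n - 2) x y ^+ 2.
Proof.
case: n hn => [|[|n]] // _; rewrite !subSS !subn0.
by apply/eqP; rewrite -subr_eq0; apply/eqP; apply: quad_defect_eq0.
Qed.
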